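(* Let $X\in\mathfrak{q}$ be such that $M=\operatorname{Ad}(H)X$ is a pseudo-Riemannian submanifold of a pseudo-hypersphere $\boldsymbol{S}=\{v\in\mathfrak{q}\mid B(v,v)=r\}$, $r>0$. Let $\xi\in T_X^\perp M$ be a normal vector of $M\hookrightarrow\boldsymbol{S}$ at $X$ and let $\xi=\xi_s+\xi_n$ be its Jordan-Chevalley decomposition. Then the decomposition $A_\xi=A_{\xi_s}+A_{\xi_n}$ is the Jordan-Chevalley decomposition of the shape operator $A_\xi$, i.e. $A_{\xi_s}$ is semisimple, $A_{\xi_n}$ is nilpotent, and $A_{\xi_s}A_{\xi_n}=A_{\xi_n}A_{\xi_s}$.
   Context: $G$ is a connected semisimple noncompact real Lie group, $\sigma$ an involution of $G$, $H$ a closed subgroup with $(G_\sigma)_0\subset H\subset G_\sigma$ ($G_\sigma$ the fixed point group of $\sigma$). $\mathfrak{g}=\operatorname{Lie}(G)$, $\mathfrak{h}=\operatorname{Lie}(H)$ is the $(+1)$-eigenspace and $\mathfrak{q}$ the $(-1)$-eigenspace of the induced involution $\sigma$ of $\mathfrak{g}$; $B$ is the Killing form of $\mathfrak{g}$. $H$ acts on $\mathfrak{q}$ by $\operatorname{Ad}$, and $\boldsymbol{S}$ carries the metric induced by $B|_{\mathfrak{q}}$. ''Pseudo-Riemannian submanifold'' means that the induced metric is nondegenerate. $T_X^\perp M$ is the normal space of $M$ in $\boldsymbol{S}$ at $X$, namely $\{\xi\in\mathfrak{q}\mid[\xi,X]=0,\ B(\xi,X)=0\}$. $A_\xi$ is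 the shape operator of $M\hookrightarrow\boldsymbol{S}$ in direction $\xi$, an endomorphism of $T_XM$. The Jordan-Chevalley decomposition $Y=Y_s+Y_n$ of $Y\in\mathfrak{g}$ is the one induced by that of $\operatorname{ad}(Y)\in\operatorname{End}(\mathfrak{g})$ ($\operatorname{ad}(Y_s)$ semisimple, $\operatorname{ad}(Y_n)$ nilpotent, $[Y_s,Y_n]=0$); semisimple means diagonalizable over $\mathbb{C}$. For $\xi\in T_X^\perp M$ the parts $\xi_s,\xi_n$ again belong to $T_X^\perp M$, so $A_{\xi_s},A_{\xi_n}$ are defined. *)

(* Defs.v *)
From HB Require Import structures.
From mathcomp Require Import all_boot all_order all_algebra.
From mathcomp Require Import all_classical all_reals all_analysis.
From mathcomp.real_closed Require Import complex.

Set Implicit Arguments.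
Unset Strict Implicit.
Unset Printing Implicit Defensive.

Import Order.TTheory GRing.Theory Num.Theory.
Import numFieldNormedType.Exports.

Local Open Scope classical_set_scope.
Local Open Scope ring_scope.

Section Endomorphisms.
Context {R : realType} {V : vectType R}.
Implicit Types f g : 'End(V).

(* Matrix of f in a fixed basis; row-vector convention, as everywhere in
   MathComp. *)
Definition end_mx f : 'M[R]_(\dim {:V}) :=
  passmx.mxof (vbasis {:V}) (vbasis {:V}) f.

Definition end_trace f : R := \tr (end_mx f).

Definition semisimple_end f : Prop :=
  diagonalizable (map_mx (real_complex R) (end_mx f)).

Definition nilpotent_end f : Prop :=
  exists k : nat, forall v : V, iter k f v = 0.

Definition jordan_chevalley f fs fn : Prop :=
  [/\ f = fs + fn, semisimple_end fs, nilpotent_end fn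
    & (fs \o fn = fn \o fs)%VF].

End Endomorphisms.

(* On an open subset of a finite-dimensional space, class C^(k+1) amounts to:
   all directional derivatives exist and are of class C^k. *)
Fixpoint class_C {R : realType} {V W : normedModType R} (k : nat)
    (f : V -> W) (U : set V) : Prop :=
  if k is k'.+1 then
    (forall x v, U x -> derivable f x v) /\
    (forall v, class_C k' (fun x => 'D_v f x) U)
  else forall x, U x -> {for x, continuous f}.

Definition smooth_on {R : realType} {V W : normedModType R}
    (f : V -> W) (U : set V) : Prop :=
  forall k, class_C k f U.

Record chart (R : realType) (n : nat) (M : topologicalType) := Chart {
  chart_dom : set M ;
  chart_map :> M -> 'rV[R]_n ;
  chart_inv : 'rV[R]_n -> M ;
  chart_dom_open : open chart_dom ;
  chart_img_open : open (chart_map @` chart_dom) ;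
  chart_continuous : forall p, chart_dom p -> {for p, continuous chart_map} ;
  chart_inv_continuous :
    forall p, chart_dom p -> {for chart_map p, continuous chart_inv} ;
  chart_mapK : forall p, chart_dom p -> chart_inv (chart_map p) = p
}.

Definition smooth_map {R : realType} {n : nat} {M : topologicalType}
    (charts : set (chart R n M)) (f : M -> M) : Prop :=
  continuous f /\
  forall a b, charts a -> charts b ->
    smooth_on (fun x => b (f (chart_inv a x)))
              (a @` [set p | chart_dom a p /\ chart_dom b (f p)]).

HB.structure Definition PreTopologicalGroup := {G of Topological G & Group G}.

(* A real Lie group of dimension n.  The chart [lie_chart1] at the unit serves
   only to identify the tangent space at 1 with 'rV[R]_n. *)
Record lieGroup (R : realType) (n : nat) := LieGroup {
  lie_sort :> PreTopologicalGroup.type ;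
  lie_hausdorff : hausdorff_space lie_sort ;
  lie_second_countable : @second_countable lie_sort ;
  lie_atlas : set (chart R n lie_sort) ;
  lie_atlas_cover :
    forall g : lie_sort, exists2 a, lie_atlas a & chart_dom a g ;
  lie_atlas_smooth : smooth_map lie_atlas id ;
  lie_mul_continuous :
    continuous (fun p : lie_sort * lie_sort => (p.1 * p.2)%g) ;
  lie_mul_smooth : forall a b c : chart R n lie_sort,
    lie_atlas a -> lie_atlas b -> lie_atlas c ->
    smooth_on
      (fun x : 'rV[R]_n * 'rV[R]_n =>
         c (chart_inv a x.1 * chart_inv b x.2)%g)
      [set x | exists g h, [/\ chart_dom a g, chart_dom b h,
                               chart_dom c (g * h)%g & x = (a g, b h)]] ;
  lie_inv_smooth : smooth_map lie_atlas (fun g : lie_sort => g^-1%g) ;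
  lie_chart1 : chart R n lie_sort ;
  lie_chart1_atlas : lie_atlas lie_chart1 ;
  lie_chart1_dom : chart_dom lie_chart1 1%g
}.

Arguments lie_atlas {R n} _ _.

Section LieAlgebra.
Context {R : realType} {n : nat} (G : lieGroup R n).
Implicit Types (g : G) (X Y Z : 'rV[R]_n).

(* t |-> lie_point (t *: X) is a curve through 1 with velocity X at t = 0. *)
Definition lie_point X : G :=
  chart_inv (lie_chart1 G) (lie_chart1 G 1%g + X).

(* Differential at 1 of a map f : G -> G fixing 1. *)
Definition diff1 (f : G -> G) X : 'rV[R]_n :=
  derive1 (fun t : R => lie_chart1 G (f (lie_point (t *: X)))) 0.

Definition Ad g Y : 'rV[R]_n := diff1 (fun h : G => (g * h * g^-1)%g) Y.

(* [X, Y] = ad(X) Y, where ad is the differential of Ad at 1. *)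
Definition bracket X Y : 'rV[R]_n :=
  derive1 (fun t : R => Ad (lie_point (t *: X)) Y) 0.

(* The maps to which [linfun] is applied, here and below, are linear. *)
Definition ad X : 'End('rV[R]_n) := linfun (bracket X).

Definition killing X Y : R := end_trace (ad X \o ad Y)%VF.

Definition semisimple_lie : Prop :=
  forall X, (forall Y, killing X Y = 0) -> X = 0.

Definition lie_jordan_chevalley Y Ys Yn : Prop :=
  [/\ Y = Ys + Yn, semisimple_end (ad Ys), nilpotent_end (ad Yn)
    & bracket Ys Yn = 0].

Definition subgroup (H : set G) : Prop :=
  [/\ H 1%g, forall g h, H g -> H h -> H (g * h)%g
    & forall g, H g -> H g^-1%g].

End LieAlgebra.

Section SymmetricPair.
Context {R : realType} {n : nat} {G : lieGroup R n}.
Variables (sigma : G -> G) (H : set G).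
Implicit Types (X Y Z xi v w : 'rV[R]_n).

Definition lie_involution : Prop :=
  [/\ smooth_map (lie_atlas G) sigma,
      forall g h : G, sigma (g * h)%g = (sigma g * sigma h)%g
    & forall g, sigma (sigma g) = g].

Definition fixed_group : set G := [set g | sigma g = g].

Definition dsigma : 'End('rV[R]_n) := linfun (diff1 sigma).

Definition lie_h : {vspace 'rV[R]_n} := passmx.leigenspace dsigma 1.

Definition lie_q : {vspace 'rV[R]_n} := passmx.leigenspace dsigma (-1).

Definition pseudo_sphere (r : R) : set 'rV[R]_n :=
  [set v | v \in lie_q /\ killing G v v = r].

Definition Ad_orbit X : set 'rV[R]_n := [set Ad g X | g in H].

(* Tangent space at X of the orbit of X: the image of the Lie algebra of H
   under Z |-> [Z, X], the differential at 1 of the orbit map g |-> Ad(g)X. *)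
Definition orbit_tangent X : {vspace 'rV[R]_n} :=
  (linfun (fun Z => bracket G Z X) @: lie_h)%VS.

Definition pseudo_riemannian_orbit (r : R) X : Prop :=
  Ad_orbit X `<=` pseudo_sphere r /\
  forall Y, Ad_orbit X Y -> forall v, v \in orbit_tangent Y ->
    (forall w, w \in orbit_tangent Y -> killing G v w = 0) -> v = 0.

(* Normal space of the orbit in the pseudo-hypersphere through X. *)
Definition orbit_normal X : set 'rV[R]_n :=
  [set xi | [/\ xi \in lie_q, bracket G xi X = 0 & killing G xi X = 0]].

(* Orthogonal projection of q onto the tangent space at X of the
   pseudo-hypersphere through X.  The Levi-Civita covariant derivative of the
   pseudo-hypersphere is the projection of the derivative in q. *)
Definition sphere_proj X v : 'rV[R]_n :=
  v - (killing G v X / killing G X X) *: X.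

(* A is the shape operator at X in the direction xi: for every curve
   t |-> Ad(c t)X in the orbit and every normal field nu along it with
   nu(0) = xi, A maps the velocity of the curve at 0 to minus the tangential
   part of the covariant derivative of nu at 0. *)
Definition is_shape_operator X xi (A : 'End(subvs_of (orbit_tangent X))) :
    Prop :=
  forall (c : R -> G) (nu : R -> 'rV[R]_n),
    (forall t, H (c t)) -> c 0 = 1%g -> {for 0, continuous c} ->
    derivable (fun t => lie_chart1 G (c t)) 0 1 ->
    (forall t, orbit_normal (Ad (c t) X) (nu t)) -> nu 0 = xi ->
    derivable nu 0 1 ->
    forall v w : subvs_of (orbit_tangent X),
      vsval v = derive1 (fun t : R => Ad (c t) X) 0 ->
      killing G (vsval (A v)) (vsval w) =
      - killing G (sphere_proj X (derive1 nu 0)) (vsval w).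

(* When the induced metric is nondegenerate and xi is normal, exactly one
   endomorphism satisfies [is_shape_operator]. *)
Definition shape_operator X xi : 'End(subvs_of (orbit_tangent X)) :=
  xget 0 [set A | is_shape_operator xi A].

End SymmetricPair.

(* Main.v *)
Require Import Defs.
From HB Require Import structures.
From mathcomp Require Import all_boot all_order all_algebra.
From mathcomp Require Import all_classical all_reals all_analysis.
From mathcomp.real_closed Require Import complex.
From mathcomp Require Import ring lra.

Set Implicit Arguments.
Unset Strict Implicit.
Unset Printing Implicit Defensive.

Import Order.TTheory GRing.Theory Num.Theory.
Import numFieldNormedType.Exports.
Import passmx.

Local Open Scope ring_scope.

(* Write D = ad X.  On h the kernels of D and D^2 agree, because the metric of
   the orbit is nondegenerate.  If x_n is the nilpotent part of X over the complex
   numbers, then x_n is orthogonal to ker D for the Killing form, so that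
   x_n = [X, z] with z in h and D^2 z = 0, whence x_n = 0 and D is semisimple.
   Consequently T = T_X M lies in the image of D^2 and, for v = D^2 t, Weingarten's
   formula reads A_xi v = - [xi, D t]: on T the shape operator is -ad xi composed
   with the inverse of D on its image, and ad xi commutes with D.  Hence
   semisimplicity, nilpotency and commutation pass from ad xi_s and ad xi_n to
   A_(xi_s) and A_(xi_n); both are normal vectors as ker (ad xi) is contained in
   ker (ad xi_s) and the Jordan-Chevalley decomposition is unique.

   As the Lie algebra is only given through the group law in a chart at 1, the
   bracket is computed as the antisymmetrised mixed second derivative of the
   multiplication, and curves in H with a prescribed velocity in h come from a
   chart in which the involution is linear. *)

(** * Jordan decomposition and derivations over an algebraically closed field *)

(** The metric of the orbit gives information on h only: if z is in h and [X,[X,z]] = 0, invariance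
    of the Killing form B gives B([z,X],[W,X]) = B(W,[X,[z,X]]) = 0 for all W in h, so the tangent
    vector [z,X] vanishes. On q nothing of the kind is given. Semisimplicity of D is what extends
    ker D^2 = ker D, hence im D^2 = im D, to the whole algebra, and only then can D be inverted on
    T. That x_n exists as an element rests on every derivation being inner. Its orthogonality to ker
    D is a trace computation: ad x_n is nilpotent and commutes with ad y as soon as [X,y] = 0. As D
    is skew for B, im D is the orthogonal of ker D; and z can be averaged into h because x_n lies in
    q. [shape_operator] is picked by choice among operators tested on curves in H, so identifying it
    takes two halves: Weingarten's formula for an arbitrary normal field, and enough curves, each
    carrying the normal field Ad(c t) xi, to leave a single candidate. The curves must stay in H for
    all times, and H is known only to lie between the identity component of the fixed group and the
    fixed group. *)

Section NilpotentTrace.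

(** All eigenvalues are nilpotent scalars, hence 0, so the characteristic polynomial is a power of
    ['X]; its subleading coefficient is minus the trace. *)
Lemma mxtrace_nilpotent (F : closedFieldType) n (A : 'M[F]_n.+1) k :
  A ^+ k = 0 -> \tr A = 0.
Proof.
move=> Ak; have [s /esym hs] := closed_field_poly_normal (char_poly A).
have /eqP mon : lead_coef (char_poly A) == 1 := char_poly_monic A.
rewrite mon scale1r in hs.
have s0 z : z \in s -> z = 0.
  move=> zs; have : root (char_poly A) z by rewrite -hs root_prod_XsubC.
  rewrite -eigenvalue_root_char => /eigenvalueP[v vA v0].
  have : v *m A ^+ k = z ^+ k *: v.
    elim: k {Ak} => [|k IH]; first by rewrite !expr0 mulmx1 scale1r.
    by rewrite !exprSr mulmxA IH -scalemxAl vA scalerA.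
  rewrite Ak mulmx0 => /esym/eqP; rewrite scaler_eq0 (negPf v0) orbF.
  by rewrite expf_eq0 => /andP[_ /eqP].
have E : char_poly A = 'X^(size s).
  rewrite -hs (eq_big_seq (fun _ => 'X)) => [|z /s0 ->]; last by rewrite subr0.
  by rewrite big_const_seq count_predT iter_mulr_1.
have sz : size s = n.+1.
  by have := size_char_poly A; rewrite E size_polyXn => -[].
have := char_poly_trace A (ltn0Sn n); rewrite E sz coefXn /= ltn_eqF// => /esym/eqP.
by rewrite oppr_eq0 => /eqP.
Qed.

End NilpotentTrace.

Section Dunford.
Variable F : fieldType.

(** Chinese remainder theorem; evaluated at a matrix, [p] yields its semisimple part. In the
    induction step the correction [v * B * (r%:P - p)] vanishes modulo the old factors and equals
    [r%:P - p] modulo the new one, by Bezout. *)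
Lemma crt_XsubC (m : nat) (rs : seq F) : uniq rs ->
  exists p : {poly F}, forall r, r \in rs -> ('X - r%:P) ^+ m %| p - r%:P.
Proof.
elim: rs => [|r rs IH] /=; first by exists 0.
move=> /andP[rrs /IH[p hp]].
set A := ('X - r%:P) ^+ m; pose B := \prod_(t <- rs) ('X - t%:P) ^+ m.
have cAB : coprimep A B.
  rewrite /B big_seq; elim/big_ind: _ => [|p1 p2|t trs]; first exact: coprimep1.
    by rewrite coprimepMr => -> ->.
  rewrite coprimep_expl// coprimep_expr// coprimep_XsubC root_XsubC.
  by apply: contraNneq rrs => <-.
have /Bezout_eq1_coprimepP[[u v] /= uv] := cAB.
exists (p + v * B * (r%:P - p)) => t; rewrite inE => /predU1P[->|trs].
  have -> : p + v * B * (r%:P - p) - r%:P = (p - r%:P) * (1 - v * B) by ring.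
  by rewrite -uv addrK mulrA dvdp_mull.
rewrite addrAC dvdp_addl ?hp// -mulrA dvdp_mull// dvdp_mulr//.
by rewrite /B (big_rem t)//= dvdp_mulr.
Qed.

Context {n' : nat}.
Local Notation n := n'.+1.
Implicit Types (A D S : 'M[F]_n) (x y : 'rV[F]_n).

Lemma horner_mx_XsubC_exp D (a : F) k :
  horner_mx D (('X - a%:P) ^+ k) = (D - a%:M) ^+ k.
Proof. by rewrite rmorphXn /= rmorphB /= horner_mx_X horner_mx_C. Qed.

Lemma dvdp_horner_mx_ker D (p q : {poly F}) x :
  p %| q -> x *m horner_mx D p = 0 -> x *m horner_mx D q = 0.
Proof. by move=> /dvdpP[u ->] xp; rewrite mulrC rmorphM /= mulmxA xp mul0mx. Qed.

Lemma coprimep_horner_mx_ker D (p q : {poly F}) x :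
  coprimep p q -> x *m horner_mx D p = 0 -> x *m horner_mx D q = 0 -> x = 0.
Proof.
move=> /Bezout_eq1_coprimepP[[u v] /= uv] xp xq.
have : x *m horner_mx D (u * p + v * q) = x by rewrite uv rmorph1 mulmx1.
rewrite (mulrC u) (mulrC v) rmorphD !rmorphM /= mulmxDr !mulmxA xp xq !mul0mx.
by rewrite addr0.
Qed.

End Dunford.

Section DunfordClosed.
Variable F : closedFieldType.
Context {n' : nat}.
Local Notation n := n'.+1.
Implicit Types (A D S : 'M[F]_n) (x y : 'rV[F]_n).

(** Cayley-Hamilton with the uniform exponent [n] in place of the multiplicities, none of which
    exceeds [n]. *)
Lemma spectrum D : exists2 rs : seq F, uniq rs &
  horner_mx D (\prod_(r <- rs) ('X - r%:P) ^+ n) = 0.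
Proof.
have [s /esym hs] := closed_field_poly_normal (char_poly D).
have /eqP mon : lead_coef (char_poly D) == 1 := char_poly_monic D.
rewrite mon scale1r in hs.
exists (undup s); first exact: undup_uniq.
have sz : size s = n.
  by have := size_char_poly D; rewrite -hs size_prod_XsubC => -[].
have dv : \prod_(r <- s) ('X - r%:P) %| (\prod_(r <- undup s) ('X - r%:P)) ^+ n.
  rewrite -sz; set Q := \prod_(r <- undup s) _.
  have : {subset s <= s} by [].
  elim: {1 3 4}s => [|r t IH] sub; first by rewrite big_nil dvd1p.
  rewrite big_cons exprS dvdp_mul//.
    by rewrite /Q (big_rem r) ?mem_undup ?sub ?mem_head//= dvdp_mulr.
  by apply: IH => z zt; apply: sub; rewrite inE zt orbT.
rewrite prodrXl; have /dvdpP[q ->] := dv.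
by rewrite rmorphM /= hs Cayley_Hamilton mulr0.
Qed.

(* Dunford decomposition, in the form in which the semisimple part is used:
   it acts by the scalar on each generalised eigenspace, and these span. *)
Lemma dunford D : exists S, [/\ exists p, S = horner_mx D p,
  forall a x k, (k <= 2 * n)%N -> x *m (D - a%:M) ^+ k = 0 -> x *m S = a *: x &
  forall P : 'rV[F]_n -> Prop, P 0 -> (forall x y, P x -> P y -> P (x + y)) ->
    (forall a x, x *m (D - a%:M) ^+ n = 0 -> P x) -> forall x, P x].
Proof.
have [rs urs D0] := spectrum D.
(* The exponent is [2 * n] because the bracket of two vectors killed by n-th powers is only known to
   be killed by a power n + n. *)
have [p hp] := crt_XsubC (2 * n) urs.
exists (horner_mx D p); split; first by exists p.
  move=> a x k kn xk.
  have xk2 : x *m horner_mx D (('X - a%:P) ^+ (2 * n)) = 0.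
    by rewrite horner_mx_XsubC_exp -(subnKC kn) exprD mulmxA xk mul0mx.
  have [ars|anrs] := boolP (a \in rs).
    have := dvdp_horner_mx_ker (hp a ars) xk2.
    rewrite rmorphB /= horner_mx_C mulmxBr => /eqP; rewrite subr_eq0 => /eqP ->.
    by rewrite mul_mx_scalar.
  (* Here [a] is no root, so the power of ['X - a%:P] killing [x] is coprime to the polynomial that
     annihilates [D]. *)
  suff -> : x = 0 by rewrite mul0mx scaler0.
  apply: (coprimep_horner_mx_ker (q := \prod_(r <- rs) ('X - r%:P) ^+ n) _ xk2);
    last by rewrite D0 mulmx0.
  rewrite big_seq; elim/big_ind: _ => [|p1 p2|t trs]; first exact: coprimep1.
    by rewrite coprimepMr => -> ->.
  rewrite coprimep_expl// coprimep_expr// coprimep_XsubC root_XsubC.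
  by apply: contraNneq anrs => <-.
move=> P P0 PD Pg x.
have full : (x <= \sum_(i < size rs) kermxpoly D (('X - (rs`_i)%:P) ^+ n))%MS.
  rewrite -(kermxpoly_prod _ _) => [|i j _ _ ij]; last first.
    rewrite coprimep_expl// coprimep_expr// coprimep_XsubC root_XsubC.
    by rewrite nth_uniq// eq_sym.
  rewrite -(big_mkord xpredT (fun i => ('X - (rs`_i)%:P) ^+ n)).
  rewrite -(big_nth 0 xpredT (fun r => ('X - r%:P) ^+ n)).
  by apply/sub_kermxP; rewrite D0 mulmx0.
have /sub_sumsmxP[u ->] := full.
elim/big_ind: _ => // i _; apply: (Pg rs`_i).
by rewrite -mulmxA -horner_mx_XsubC_exp mulmx_ker mulmx0.
Qed.

End DunfordClosed.

(** * Semisimplicity of ad X over an algebraically closed field *)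

Section AdSemisimple.
Variable F : closedFieldType.
Hypothesis F2 : 2%:R != 0 :> F.
Context {n' : nat}.
Local Notation n := n'.+1.
Implicit Types (x y z : 'rV[F]_n) (E S N : 'M[F]_n).

Variable AD : {linear 'rV[F]_n -> 'M[F]_n}.
Hypothesis AD_jacobi : forall x y,
  AD (y *m AD x) = AD y *m AD x - AD x *m AD y.
Hypothesis AD_nondeg : forall x, (forall y, \tr (AD x *m AD y) = 0) -> x = 0.

(** Row vectors act from the left, so [y *m AD x] stands for the bracket [x, y] and this is the
    Leibniz rule. *)
Definition derivation E := forall x y,
  y *m AD x *m E = y *m AD (x *m E) + y *m E *m AD x.

Lemma derivation_ad E x : derivation E -> AD (x *m E) = AD x *m E - E *m AD x.
Proof.
move=> dE; apply/row_matrixP => i; rewrite !rowE mulmxBr !mulmxA (dE x).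
by rewrite addrK.
Qed.

Lemma ad_derivation s : derivation (AD s).
Proof. by move=> x y; rewrite AD_jacobi mulmxBr !mulmxA subrK. Qed.

Lemma derivationB E S : derivation E -> derivation S -> derivation (E - S).
Proof.
move=> dE dS x y; rewrite !mulmxBr linearB mulmxBr mulmxBl (dE x y) (dS x y).
by rewrite opprD addrACA.
Qed.

(** Gram matrix of the Killing form; [G_unit] below expresses nondegeneracy. *)
Let G : 'M[F]_n := \matrix_(i, j) \tr (AD (delta_mx 0 i) *m AD (delta_mx 0 j)).

Let AD_sum x : AD x = \sum_i x 0 i *: AD (delta_mx 0 i).
Proof.
by rewrite {1}(row_sum_delta x) linear_sum; apply: eq_bigr => i _; rewrite linearZ.
Qed.

Let G_E x y : \tr (AD x *m AD y) = (x *m G *m y^T) 0 0.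
Proof.
rewrite (AD_sum x) (AD_sum y) mulmx_suml (raddf_sum (@mxtrace F n)) -mulmxA !mxE.
apply: eq_bigr => i _; rewrite /= -scalemxAl mxtraceZ mulmx_sumr (raddf_sum (@mxtrace F n)) !mxE.
congr (_ * _); apply: eq_bigr => j _.
by rewrite /= -scalemxAr mxtraceZ !mxE mulrC.
Qed.

Let G_unit : G \in unitmx.
Proof.
rewrite -row_free_unit; apply/row_freeP.
have : kermx G = 0.
  apply/row_matrixP => i; rewrite row0; apply: AD_nondeg => y.
  by rewrite G_E -row_mul mulmx_ker row0 mul0mx mxE.
move=> /eqP; rewrite kermx_eq0 => /row_freeP[B GB]; exists B => //.
Qed.

(** The functional y |-> tr(E ad y) is represented by some s through the nondegenerate Killing form.
    The derivation E' = E - ad s is then trace-orthogonal to all ad y, and tr(ad(E'x) ad y) is the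
    trace of E' against the ad of a bracket, hence 0, which forces E'x = 0. *)
Lemma derivation_inner E : derivation E -> exists s, E = AD s.
Proof.
move=> dE; pose v : 'rV[F]_n := \row_j \tr (E *m AD (delta_mx 0 j)).
have vE y : \tr (E *m AD y) = (v *m y^T) 0 0.
  rewrite (AD_sum y) mulmx_sumr (raddf_sum (@mxtrace F n)) !mxE; apply: eq_bigr => j _.
  by rewrite /= -scalemxAr mxtraceZ !mxE mulrC.
exists (v *m invmx G); apply/eqP; rewrite -subr_eq0; apply/eqP.
set s := v *m _; set E' := E - AD s.
have dE' : derivation E' := derivationB dE (ad_derivation s).
have tE y : \tr (E' *m AD y) = 0.
  by rewrite /E' mulmxBl linearB /= vE G_E /s mulmxKV// subrr.
apply/row_matrixP => i; rewrite row0 rowE; apply: AD_nondeg => y.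
rewrite (derivation_ad _ dE') mulmxBl linearB /= -mulmxA mxtrace_mulC -mulmxA.
rewrite -[E' *m _ *m _]mulmxA -linearB /= -mulmxBr -AD_jacobi; exact: tE.
Qed.

Section Elt.
Variables (sig : 'M[F]_n) (X : 'rV[F]_n).
Hypothesis sigK : sig *m sig = 1%:M.
Hypothesis sig_aut : forall x y, y *m AD x *m sig = y *m sig *m AD (x *m sig).
Hypothesis X_q : X *m sig = - X.
Local Notation D := (AD X).
Hypothesis D2 : forall z, z *m sig = z -> z *m D *m D = 0 -> z *m D = 0.

Let Leibniz a b x y : y *m AD x *m (D - (a + b)%:M) =
  y *m AD (x *m (D - a%:M)) + y *m (D - b%:M) *m AD x.
Proof.
have alg (P Q R T : 'rV[F]_n) : P - (Q + R) = P - T - Q + (T - R).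
  by apply/rowP => i; rewrite !mxE; ring.
rewrite !mulmxBr !mul_mx_scalar scalerDl linearB linearZ /= AD_jacobi mulmxBl.
by rewrite !mulmxBr -scalemxAr -scalemxAl !mulmxA; exact: alg.
Qed.

(** Generalised eigenspaces for a and b bracket into the one for a + b: [Leibniz] splits one factor
    of the power into a term with smaller k and a term with smaller l. *)
Let gen_bracket a b k l x y :
  x *m (D - a%:M) ^+ k = 0 -> y *m (D - b%:M) ^+ l = 0 ->
  y *m AD x *m (D - (a + b)%:M) ^+ (k + l) = 0.
Proof.
have [m] := ubnP (k + l); elim: m k l x y => // m IH [|k] l x y klm.
  by rewrite expr0 mulmx1 => -> _; rewrite linear0 mulmx0 mul0mx.
case: l klm => [|l] klm xk; first by rewrite expr0 mulmx1 => ->; rewrite !mul0mx.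
move=> yl; rewrite addSn exprS -mulmxE mulmxA (Leibniz a b) mulmxDl.
have h1 : y *m AD (x *m (D - a%:M)) *m (D - (a + b)%:M) ^+ (k + l.+1) = 0.
  by apply: IH => //; rewrite -mulmxA mulmxE -exprS.
have h2 : y *m (D - b%:M) *m AD x *m (D - (a + b)%:M) ^+ (k.+1 + l) = 0.
  apply: IH => //; first by rewrite addSnnS.
  by rewrite -mulmxA mulmxE -exprS.
by rewrite h1 add0r -addSnnS.
Qed.

Let D_skew x y : \tr (AD (x *m D) *m AD y) = - \tr (AD x *m AD (y *m D)).
Proof.
rewrite !AD_jacobi mulmxBl mulmxBr !linearB /= opprB.
by rewrite -!mulmxA (mxtrace_mulC D) -!mulmxA.
Qed.

(** The image of [D] is the orthogonal of its kernel, because [D] is skew for the Killing form. *)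
Let im_perp x : (forall y, y *m D = 0 -> \tr (AD x *m AD y) = 0) ->
  exists z, x = z *m D.
Proof.
move=> hx.
have DG : D *m G = - (G *m D^T).
  apply/matrixP => i j.
  have := D_skew (delta_mx 0 i) (delta_mx 0 j); rewrite !G_E.
  rewrite trmx_mul mulmxA -(mulmxA _ D G) -(mulmxA _ G D^T).
  have ent (A : 'M[F]_n) : ((delta_mx 0 i : 'rV_n) *m A *m (delta_mx 0 j : 'rV_n)^T) 0 0 = A i j.
    by rewrite -rowE trmx_delta -colE !mxE.
  by rewrite !ent => ->; rewrite [RHS]mxE.
have : (x *m G <= D^T)%MS.
  have k0 : x *m G *m (kermx D)^T = 0.
    apply: (can_inj trmxK); rewrite trmx0 trmx_mul trmxK; apply/row_matrixP => i.
    rewrite row0 row_mul; apply/rowP => j; rewrite (ord1 j) [RHS]mxE.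
    have h0 : row i (kermx D) *m D = 0 by rewrite -row_mul mulmx_ker row0.
    have := hx _ h0; rewrite G_E => <-.
    by rewrite -[in RHS](trmxK (x *m G)) -trmx_mul [RHS]mxE.
  have eqk : (D^T :=: kermx (kermx D)^T)%MS.
    apply/eqmxP; rewrite -mxrank_leqif_eq; last first.
      by apply/sub_kermxP; rewrite -trmx_mul mulmx_ker trmx0.
    by rewrite mxrank_ker !mxrank_tr mxrank_ker subKn ?rank_leq_row.
  by rewrite eqk; apply/sub_kermxP.
move=> /submxP[w xw].
(* From x G = w D^T and the skewness D G = - G D^T. *)
exists (- (w *m invmx G)).
rewrite mulNmx -mulmxA; apply: (can_inj (mulmxK G_unit)).
by rewrite mulNmx -!mulmxA DG !mulmxN opprK mulKmx.
Qed.

Let AD_inj x y : AD x = AD y -> x = y.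
Proof.
move=> xy; apply/eqP; rewrite -subr_eq0; apply/eqP/AD_nondeg => z.
by rewrite linearB /= xy subrr mul0mx linear0.
Qed.

Let sig_D z : z *m sig *m D = - (z *m D *m sig).
Proof. by rewrite sig_aut X_q linearN /= mulmxN opprK. Qed.

Lemma eigenvector_horner_mx (E : 'M[F]_n) a x (q : {poly F}) :
  x *m E = a *: x -> x *m horner_mx E q = q.[a] *: x.
Proof.
move=> xE; have xa : x *m horner_mx E ('X - a%:P) = 0.
  by rewrite rmorphB /= horner_mx_X horner_mx_C mulmxBr mul_mx_scalar xE subrr.
have dv : 'X - a%:P %| q - (q.[a])%:P.
  by rewrite dvdp_XsubCl /root !hornerE subrr.
have := dvdp_horner_mx_ker dv xa.
rewrite rmorphB /= horner_mx_C mulmxBr mul_mx_scalar => /eqP.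
by rewrite subr_eq0 => /eqP.
Qed.

Theorem ad_diagonalizable : diagonalizable D.
Proof.
have [S [[p Sp] hS ind]] := dunford D.
have n2 : (n <= 2 * n)%N by rewrite leq_pmull.
(* By additivity it suffices to test generalised eigenvectors, where [S] acts by a, b and, on the
   bracket, a + b. *)
have dS : derivation S.
  move=> x y; apply/eqP; rewrite -subr_eq0; apply/eqP; move: x.
  have alg (A B C A' B' C' : 'rV[F]_n) :
      (A + A') - (B + B' + (C + C')) = A - (B + C) + (A' - (B' + C')).
    by apply/rowP => i; rewrite !mxE; ring.
  apply: (ind) => [|x1 x2 h1 h2|a x xa].
  - by rewrite (mul0mx _ S) (linear0 AD) !mulmx0 mul0mx addr0 subrr.
  - rewrite (mulmxDl x1 x2 S) !(linearD AD) !mulmxDr (mulmxDl (y *m AD x1)).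
    by rewrite alg h1 h2 addr0.
  move: y; apply: (ind) => [|y1 y2 h1 h2|b y yb].
  - by rewrite !mul0mx addr0 subrr.
  - by rewrite !mulmxDl alg h1 h2 addr0.
  have h : y *m AD x *m S = (a + b) *: (y *m AD x).
    by apply: hS (gen_bracket xa yb); rewrite addnn mul2n.
  rewrite h (hS a x n)// (hS b y n)// linearZ /= -scalemxAr -scalemxAl -scalerDl.
  by rewrite subrr.
have [s Ss] := derivation_inner dS.
pose N := D - S.
have NX : N = AD (X - s) by rewrite /N linearB /= Ss.
have comS E : GRing.comm D E -> GRing.comm S E.
  by move=> DE; rewrite Sp; apply/commr_sym; apply: comm_mx_horner; exact: commr_sym.
have comSD : GRing.comm S D by apply: comS.
have Nn : N ^+ n = 0.
  have xN x a k : x *m S = a *: x -> x *m N ^+ k = x *m (D - a%:M) ^+ k.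
    move=> xS; elim: k => [|k IH]; first by rewrite !expr0.
    have cS : GRing.comm S ((D - a%:M) ^+ k).
      apply: commrX; apply: commrB => //; exact: comm_mx_scalar.
    rewrite !exprSr -!mulmxE !mulmxA IH /N !mulmxBr; congr (_ - _).
    rewrite -mulmxA -[_ ^+ k *m S]cS mulmxA xS mul_mx_scalar.
    by rewrite -scalemxAl.
  apply/row_matrixP => i; rewrite row0 rowE; move: (delta_mx 0 i).
  apply: (ind) => [|x y h1 h2|a x xa]; first by rewrite mul0mx.
    by rewrite mulmxDl h1 h2 addr0.
  by rewrite (xN x a)// (hS a x n).
(* If [X, y] = 0 then [AD y] commutes with [D], hence with [N], as [S] is a polynomial in [D]; the
   product of [N] with [AD y] is then nilpotent and has trace 0. *)
have Nperp y : y *m D = 0 -> \tr (AD (X - s) *m AD y) = 0.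
  move=> yD; have cD : GRing.comm D (AD y).
    have := AD_jacobi X y; rewrite yD linear0 => /esym/eqP.
    by rewrite subr_eq0 => /eqP.
  have cN : GRing.comm N (AD y).
    by apply/commr_sym/commrB; apply/commr_sym => //; exact: comS.
  rewrite -NX; apply: (@mxtrace_nilpotent _ _ _ n).
  by rewrite mulmxE exprMn_comm// Nn mul0r.
have [z xz] := im_perp Nperp.
have NsD : (X - s) *m D = 0.
  apply: AD_inj; rewrite linear0 AD_jacobi -NX /N mulmxBl mulmxBr.
  by rewrite -[S *m D]/(S * D) comSD subrr.
(* [sig] anticommutes with [D], so it exchanges the generalised eigenspaces for a and -a, on which
   [S] acts by opposite scalars. *)
have sigS x : x *m sig *m S = - (x *m S *m sig).
  apply/eqP; rewrite -addr_eq0; apply/eqP; move: x.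
  apply: (ind) => [|x y h1 h2|a x xa]; first by rewrite !mul0mx addr0.
    by rewrite !mulmxDl addrACA h1 h2 addr0.
  have sigk k (w : 'rV[F]_n) : w *m sig *m (D - (- a)%:M) ^+ k =
      (-1) ^+ k *: (w *m (D - a%:M) ^+ k *m sig).
    elim: k w => [|k IH] w; first by rewrite !expr0 !mulmx1 scale1r.
    rewrite !exprS -!mulmxE !mulmxA.
    have -> : w *m sig *m (D - (- a)%:M) = - (w *m (D - a%:M)) *m sig.
      rewrite !mulmxBr sig_D !mul_mx_scalar scaleNr opprK mulNmx mulmxBl opprB.
      by rewrite -scalemxAl addrC.
    by rewrite !mulNmx IH mulN1r scaleNr.
  rewrite (hS (- a) (x *m sig) n)// ?sigk ?xa ?mul0mx ?scaler0//.
  by rewrite (hS a x n)// -scalemxAl scaleNr addNr.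
have Nsig : (X - s) *m sig = - (X - s).
  rewrite mulmxBl X_q opprB addrC; congr (_ + _); apply: oppr_inj; rewrite opprK.
  apply: AD_inj; rewrite linearN /= -Ss.
  apply/row_matrixP => i; rewrite !rowE mulmxN; set d := delta_mx 0 i.
  have := sig_aut s (d *m sig); rewrite -(mulmxA d sig sig) sigK mulmx1 => <-.
  by rewrite -Ss sigS mulNmx -!mulmxA sigK mulmx1.
have zsD : z *m sig *m D = z *m D by rewrite sig_D -xz Nsig opprK.
(* The average of [z] and its image under [sig] is fixed by [sig] and has the same image X - s under
   [D], because X - s is in the (-1)-eigenspace. As [D] kills X - s, the hypothesis [D2] applies to
   it. *)
pose zh := 2^-1 *: (z + z *m sig).
have zhD : zh *m D = X - s.
  by rewrite -scalemxAl mulmxDl zsD -xz -mulr2n -scaler_nat scalerA mulVf// scale1r.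
have zhs : zh *m sig = zh.
  by rewrite -scalemxAl mulmxDl -mulmxA sigK mulmx1 addrC.
have x0 : X - s = 0 by rewrite -zhD D2// zhD.
have DS : D = S by apply/eqP; rewrite -subr_eq0 -/N NX x0 linear0.
(* Now [D] acts by scalars on generalised eigenvectors, so where the product of the n-th powers
   vanishes, the product of the simple factors vanishes too. *)
apply/diagonalizableP; have [rs urs D0] := spectrum D.
exists rs => //; apply/mxminpoly_minP.
apply/row_matrixP => i; rewrite row0 rowE; move: (delta_mx 0 i).
apply: (ind) => [|x y h1 h2|a x xa]; first by rewrite mul0mx.
  by rewrite mulmxDl h1 h2 addr0.
have xDa : x *m D = a *: x by rewrite DS (hS a x n).
have := congr1 (mulmx x) D0; rewrite !(eigenvector_horner_mx _ xDa) mulmx0 prodrXl.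
move=> /eqP; rewrite scaler_eq0 horner_exp expf_eq0 /= => /orP[/eqP ->|/eqP ->].
  by rewrite scale0r.
by rewrite scaler0.
Qed.

End Elt.
End AdSemisimple.

Lemma ad_diagonalizable_any (F : closedFieldType) n
    (AD : {linear 'rV[F]_n -> 'M[F]_n}) (sig : 'M[F]_n) (X : 'rV[F]_n) :
  2%:R != 0 :> F ->
  (forall x y : 'rV[F]_n, AD (y *m AD x) = AD y *m AD x - AD x *m AD y) ->
  (forall x : 'rV[F]_n, (forall y : 'rV[F]_n, \tr (AD x *m AD y) = 0) -> x = 0) ->
  sig *m sig = 1%:M ->
  (forall x y : 'rV[F]_n, y *m AD x *m sig = y *m sig *m AD (x *m sig)) ->
  X *m sig = - X ->
  (forall z : 'rV[F]_n, z *m sig = z -> z *m AD X *m AD X = 0 -> z *m AD X = 0) ->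
  diagonalizable (AD X).
Proof.
case: n AD sig X => [|n] AD sig X; last first.
  by move=> h1 h2 h3 h4 h5 h6 h7; exact: (ad_diagonalizable h1 h2 h3 h4 h5 h6 h7).
by move=> *; rewrite flatmx0; exact: diagonalizable0.
Qed.

Section IterMulmx.
Variable F : closedFieldType.
Implicit Types n : nat.

Lemma iter_mulmx_linear n (A : 'M[F]_n) k : linear (iter k (fun x : 'rV_n => x *m A)).
Proof.
by move=> c x y; elim: k => //= k ->; rewrite mulmxDl -scalemxAl.
Qed.

Lemma mxtrace_nilpotent_iter n (A : 'M[F]_n) k :
  (forall x, iter k (fun x : 'rV_n => x *m A) x = 0) -> \tr A = 0.
Proof.
case: n A => [|n] A h; first by rewrite /mxtrace big_ord0.
apply: (@mxtrace_nilpotent _ _ _ k); apply/row_matrixP => i; rewrite row0 rowE.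
rewrite -(h (delta_mx 0 i)); elim: (k) => [|m IH]; first by rewrite expr0 mulmx1.
by rewrite exprSr -mulmxE mulmxA IH.
Qed.

End IterMulmx.

(** * Diagonalizable matrices: kernels, commuting pairs, quotients, restrictions *)

Section Diagonalizable.
Variable F : fieldType.

Lemma diagonalizableE n (S : 'M[F]_n) : diagonalizable S <->
  exists2 P : 'M[F]_n, P \in unitmx & exists d, P *m S = diag_mx d *m P.
Proof.
split=> [[P Pu /diagonalizable_forPex[d /(simmxP Pu) PS]]|[P Pu [d PS]]].
  by exists P => //; exists d.
by exists P => //; apply/diagonalizable_forPex; exists d; apply/simmxP.
Qed.

Lemma diag_mx_sqr_ker n (d y : 'rV[F]_n) k :
  iter k (fun v : 'rV_n => v *m diag_mx d) y = 0 -> y *m diag_mx d = 0.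
Proof.
have it m i : (iter m (fun v : 'rV_n => v *m diag_mx d) y) 0 i = y 0 i * d 0 i ^+ m.
  elim: m => [|m IH] /=; first by rewrite expr0 mulr1.
  by rewrite mul_mx_diag mxE IH exprSr mulrA.
move=> /rowP h; apply/rowP => i; have := h i.
rewrite it mul_mx_diag !mxE => /eqP; rewrite mulf_eq0 expf_eq0.
by move=> /orP[/eqP ->|/andP[_ /eqP ->]]; rewrite ?mul0r ?mulr0.
Qed.

Lemma diagonalizable_iter_ker n (S : 'M[F]_n) x k : diagonalizable S ->
  iter k (fun v : 'rV_n => v *m S) x = 0 -> x *m S = 0.
Proof.
move=> /diagonalizableE[P Pu [d PS]] xk.
have SP y : y *m P *m S = y *m diag_mx d *m P by rewrite -!mulmxA PS.
have it m y : iter m (fun v : 'rV_n => v *m S) (y *m P) =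
    iter m (fun v : 'rV_n => v *m diag_mx d) y *m P.
  by elim: m => //= m ->; rewrite SP.
move: xk; rewrite -[x](mulmxKV Pu) it => /(congr1 (mulmx^~ (invmx P))) /=.
by rewrite mulmxK// mul0mx SP => /diag_mx_sqr_ker ->; rewrite mul0mx.
Qed.

Lemma codiagonalizable2 n (S T : 'M[F]_n) : diagonalizable S -> diagonalizable T ->
  S *m T = T *m S -> exists2 P : 'M[F]_n, P \in unitmx &
    exists d e, P *m S = diag_mx d *m P /\ P *m T = diag_mx e *m P.
Proof.
move=> dS dT ST.
have /codiagonalizableP[P Pu] : {in [:: S; T] &, forall A B, comm_mx A B} /\
    {in [:: S; T], forall A, diagonalizable A}.
  split=> [A B|A]; rewrite !inE; last by move=> /orP[] /eqP ->.
  by move=> /orP[] /eqP -> /orP[] /eqP ->; rewrite /comm_mx ?ST.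
rewrite /= andbT => /andP[/diagonalizable_forPex[d /(simmxP Pu) h1]].
move=> /diagonalizable_forPex[e /(simmxP Pu) h2].
by exists P => //; exists d, e.
Qed.

Lemma diagonalizableB n (S T : 'M[F]_n) : diagonalizable S -> diagonalizable T ->
  S *m T = T *m S -> diagonalizable (S - T).
Proof.
move=> dS dT ST; have [P Pu [d [e [h1 h2]]]] := codiagonalizable2 dS dT ST.
apply/diagonalizableE; exists P => //; exists (d - e).
by rewrite mulmxBr h1 h2 -mulmxBl; congr (_ *m _); rewrite linearB.
Qed.

(** In a common eigenbasis take the quotients e_i / d_i. Where d_i = 0 both sides of the equation
    vanish, whatever the value of the quotient. With S = ad X and T = ad y, this K sends D^2 t to
    [y, D t], which is minus the shape operator. *)
Lemma diagonalizable_quotient n (S T : 'M[F]_n) :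
  diagonalizable S -> diagonalizable T -> S *m T = T *m S ->
  exists2 K, diagonalizable K & S *m S *m K = S *m T.
Proof.
move=> dS dT ST; have [P Pu [d [e [h1 h2]]]] := codiagonalizable2 dS dT ST.
pose k := \row_i (e 0 i / d 0 i).
have [K PK] : exists K, P *m K = diag_mx k *m P.
  by exists (invmx P *m diag_mx k *m P); rewrite !mulmxA mulmxV// mul1mx.
exists K; first by apply/diagonalizableE; exists P => //; exists k.
have dk : diag_mx d *m diag_mx d *m diag_mx k = diag_mx d *m diag_mx e.
  rewrite !mulmx_diag; congr diag_mx; apply/rowP => i; rewrite !mxE.
  have [->|d0] := eqVneq (d 0 i) 0; first by rewrite !mul0r.
  by rewrite -mulrA (mulrC _ (_ / _)) divfK.
apply: (can_inj (mulKmx Pu)); rewrite !mulmxA h1 -(mulmxA _ P S) h1 mulmxA.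
by rewrite -(mulmxA _ P K) PK mulmxA dk -(mulmxA _ P T) h2 mulmxA.
Qed.

(** [J] embeds the space of [M] as a [K]-stable subspace, so the polynomial with simple roots that
    annihilates [K] annihilates [M]. *)
Lemma diagonalizable_restrict m n (M : 'M[F]_m) (K : 'M[F]_n) (J : 'M[F]_(m, n)) :
  row_free J -> M *m J = J *m K -> diagonalizable K -> diagonalizable M.
Proof.
case: m n => [|m] [|n] in M K J *.
- by move=> *; rewrite flatmx0; exact: diagonalizable0.
- by move=> *; rewrite flatmx0; exact: diagonalizable0.
- by rewrite /row_free thinmx0 mxrank0.
move=> Jf MJ /diagonalizableP[rs urs mK].
apply/diagonalizableP; exists rs => //; apply/mxminpoly_minP.
move/mxminpoly_minP: mK => K0.
have hJ (p : {poly F}) : horner_mx M p *m J = J *m horner_mx K p.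
  elim/poly_ind: p => [|p c IH]; first by rewrite !rmorph0 mul0mx mulmx0.
  rewrite !rmorphD !rmorphM /= !horner_mx_X !horner_mx_C mulmxDl mulmxDr.
  by rewrite mul_scalar_mx mul_mx_scalar -!mulmxE -mulmxA MJ !mulmxA IH.
by apply: (row_free_inj Jf); rewrite hJ K0 mulmx0 mul0mx.
Qed.

End Diagonalizable.

(** * Endomorphisms of a real vector space *)

Section Complexification.
Context {R : realType} {V : vectType R}.
Local Notation C := (R[i]).
Local Notation iota := (real_complex R).
Local Notation d := (\dim {:V}).
Implicit Types (f g : 'End(V)) (u v w : V).

Definition cplx_mx f : 'M[C]_d := map_mx iota (end_mx f).

Definition cplx_rv v : 'rV[C]_d := map_mx iota (passmx.rVof (vbasis {:V}) v).

Let B_basis : basis_of {:V} (vbasis {:V}) := vbasisP _.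

Lemma cplx_rv_app f v : cplx_rv (f v) = cplx_rv v *m cplx_mx f.
Proof.
rewrite /cplx_rv /cplx_mx /end_mx -map_mxM; congr map_mx.
exact: passmx.rVof_app.
Qed.

Lemma cplx_rv_inj v : cplx_rv v = 0 -> v = 0.
Proof.
move=> /eqP; by rewrite map_mx_eq0 (passmx.rVof_eq0 B_basis) => /eqP.
Qed.

Lemma cplx_rvD u v : cplx_rv (u + v) = cplx_rv u + cplx_rv v.
Proof. by rewrite /cplx_rv linearD map_mxD. Qed.

Lemma cplx_rvN v : cplx_rv (- v) = - cplx_rv v.
Proof. by rewrite /cplx_rv linearN map_mxN. Qed.

Lemma cplx_rv0 : cplx_rv 0 = 0.
Proof. by rewrite /cplx_rv linear0 map_mx0. Qed.

Lemma cplx_mx_comp f g : cplx_mx (f \o g)%VF = cplx_mx g *m cplx_mx f.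
Proof.
by rewrite /cplx_mx /end_mx (passmx.mxof_comp (vbasis {:V}) (vbasis {:V}) B_basis) map_mxM.
Qed.

Lemma cplx_mxD f g : cplx_mx (f + g) = cplx_mx f + cplx_mx g.
Proof. by rewrite /cplx_mx /end_mx linearD map_mxD. Qed.

Lemma cplx_mxN f : cplx_mx (- f) = - cplx_mx f.
Proof. by rewrite /cplx_mx /end_mx linearN map_mxN. Qed.

Lemma cplx_mxB f g : cplx_mx (f - g) = cplx_mx f - cplx_mx g.
Proof. by rewrite cplx_mxD cplx_mxN. Qed.

Lemma cplx_mxZ (k : R) f : cplx_mx (k *: f) = k%:C%C *: cplx_mx f.
Proof. by rewrite /cplx_mx /end_mx linearZ map_mxZ. Qed.

Lemma cplx_mx1 : cplx_mx \1%VF = 1%:M.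
Proof. by rewrite /cplx_mx /end_mx passmx.mxof1 ?map_mx1// (basis_free B_basis). Qed.

Lemma cplx_mx_trace f : \tr (cplx_mx f) = (end_trace f)%:C%C.
Proof. by rewrite /cplx_mx trace_map_mx. Qed.

Lemma cplx_rv_basis (i : 'I_d) : cplx_rv (vbasis {:V})`_i = delta_mx 0 i.
Proof. by rewrite /cplx_rv (passmx.rVofE B_basis) map_delta_mx. Qed.

(** Real vectors span the complexification, so identities that are linear over the complex numbers
    need only be tested on them. *)
Lemma cplx_rv_ind (P : 'rV[C]_d -> Prop) :
  (forall v, P (cplx_rv v)) -> (forall x y, P x -> P y -> P (x + y)) ->
  (forall (k : C) x, P x -> P (k *: x)) -> forall x, P x.
Proof.
move=> Pr PD PZ x; rewrite (row_sum_delta x).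
elim/big_ind: _ => //; first by rewrite -cplx_rv0; exact: Pr.
by move=> i _; apply: PZ; rewrite -cplx_rv_basis; exact: Pr.
Qed.

Lemma cplx_rv_ReIm (x : 'rV[C]_d) : exists u v, x = cplx_rv u + 'i *: cplx_rv v.
Proof.
exists (passmx.vecof (vbasis {:V}) (map_mx (@complex.Re R) x)),
       (passmx.vecof (vbasis {:V}) (map_mx (@complex.Im R) x)).
apply/rowP => i; rewrite /cplx_rv !(passmx.vecofK B_basis) !mxE.
by rewrite [LHS]complexE.
Qed.

Lemma cplx_rv_ReIm0 u v : cplx_rv u + 'i *: cplx_rv v = 0 -> u = 0 /\ v = 0.
Proof.
move=> h.
suff [hu hv] : cplx_rv u = 0 /\ cplx_rv v = 0 by split; exact: cplx_rv_inj.
have hi i : (cplx_rv u + 'i *: cplx_rv v) 0 i = 0 by rewrite h mxE.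
by split; apply/rowP => i; have := hi i; rewrite !mxE => /eqP;
   rewrite eq_complex /= !mulr0 !mul0r !mul1r ?subr0 ?addr0 ?add0r =>
     /andP[/eqP e1 /eqP e2]; rewrite ?e1 ?e2.
Qed.

End Complexification.

Lemma linfunE (F : fieldType) (U V : vectType F) (f : U -> V) : linear f ->
  linfun f =1 f.
Proof.
move=> lf u; pose fL : {linear U -> V} := HB.pack f (GRing.isLinear.Build _ _ _ _ _ lf).
exact: (lfunE fL).
Qed.

Section Endomorphisms.
Context {R : realType} {V : vectType R}.
Implicit Types (f g : 'End(V)) (u v w : V).

Lemma cplx_rv_iter f k v :
  cplx_rv (iter k f v) = iter k (fun x : 'rV_(\dim {:V}) => x *m cplx_mx f) (cplx_rv v).
Proof. by elim: k => //= k IH; rewrite cplx_rv_app IH. Qed.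

Lemma semisimple_iter_ker f k v : semisimple_end f -> iter k f v = 0 -> f v = 0.
Proof.
move=> sf fk; apply: cplx_rv_inj; rewrite cplx_rv_app.
by apply: (diagonalizable_iter_ker (k := k)) => //; rewrite -cplx_rv_iter fk cplx_rv0.
Qed.

Lemma iter_lfun0 f k : iter k f 0 = 0.
Proof. by elim: k => //= k ->; rewrite linear0. Qed.

Lemma iter_lfunD f k u v : iter k f (u + v) = iter k f u + iter k f v.
Proof. by elim: k => //= k ->; rewrite linearD. Qed.

Lemma iter_lfunN f k v : iter k f (- v) = - iter k f v.
Proof. by elim: k => //= k ->; rewrite linearN. Qed.

Lemma iter_commute f g k v : (forall v, f (g v) = g (f v)) ->
  iter k f (g v) = g (iter k f v).
Proof. by move=> fg; elim: k => //= k ->; rewrite fg. Qed.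

(** On the kernel of the sum [fs] equals [- fn], so a power of [fs] kills [v]; a semisimple map has
    the same kernel as its powers. *)
Lemma jordan_ker fs fn v : semisimple_end fs -> nilpotent_end fn ->
  (forall v, fs (fn v) = fn (fs v)) -> (fs + fn) v = 0 -> fs v = 0 /\ fn v = 0.
Proof.
move=> ss [k nk] c; rewrite lfunE /= => /eqP; rewrite addr_eq0 => /eqP sn.
have it m : iter m fs v = (-1) ^+ m *: iter m fn v.
  elim: m => [|m IH]; first by rewrite expr0 scale1r.
  rewrite iterS IH linearZ /= -iter_commute; last by move=> w; rewrite c.
  by rewrite sn iter_lfunN scalerN -scaleNr -mulN1r -exprS -iterSr.
have s0 : fs v = 0 by apply: (semisimple_iter_ker (k := k)) => //; rewrite it nk scaler0.
by split => //; apply/eqP; rewrite -oppr_eq0 -sn s0.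
Qed.

(** Binomial argument at a single vector [w], by induction on k + l: [f w] needs one power of [f]
    less and [g w] one power of [g] less. *)
Lemma nilpotentB f g : nilpotent_end f -> nilpotent_end g ->
  (forall v, f (g v) = g (f v)) -> nilpotent_end (f - g).
Proof.
move=> [a fa] [b gb] c; exists (a + b)%N => v.
suff h k l w : iter k f w = 0 -> iter l g w = 0 -> iter (k + l) (f - g) w = 0.
  exact: h.
have [m] := ubnP (k + l); elim: m k l w => // m IH [|k] l w.
  by move=> _ /= -> _; rewrite iter_lfun0.
case: l => [|l] klm fk gl; first by rewrite /= in gl; rewrite gl iter_lfun0.
have h1 : iter (k + l.+1) (f - g) (f w) = 0.
  apply: IH; [by []|by rewrite -iterSr|].
  by rewrite iter_commute ?gl ?linear0// => u; rewrite c.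
have h2 : iter (k + l.+1) (f - g) (g w) = 0.
  rewrite -addSnnS; apply: IH; [by rewrite addSnnS| |by rewrite -iterSr].
  by rewrite iter_commute// fk linear0.
rewrite addSn iterSr add_lfunE opp_lfunE iter_lfunD h1 add0r.
by rewrite iter_lfunN h2 oppr0.
Qed.

Lemma semisimple_nilpotent0 f : semisimple_end f -> nilpotent_end f -> f = 0.
Proof.
move=> sf [k fk]; apply/lfunP => v; rewrite zero_lfunE.
exact: (semisimple_iter_ker (k := k)).
Qed.

Lemma semisimpleB f g : semisimple_end f -> semisimple_end g ->
  (forall v, f (g v) = g (f v)) -> semisimple_end (f - g).
Proof.
move=> sf sg c; rewrite /semisimple_end -/(cplx_mx (f - g)) cplx_mxB.
apply: (diagonalizableB sf sg); apply: etrans (esym (cplx_mx_comp g f)) _.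
apply: etrans _ (cplx_mx_comp f g); congr cplx_mx.
by apply/lfunP => v; rewrite !comp_lfunE c.
Qed.

(** The difference fs - gs = gn - fn is at once semisimple and nilpotent. *)
Lemma jordan_unique fs fn gs gn : semisimple_end fs -> nilpotent_end fn ->
  semisimple_end gs -> nilpotent_end gn -> fs + fn = gs + gn ->
  (forall v, fs (gs v) = gs (fs v)) -> (forall v, fn (gn v) = gn (fn v)) ->
  fs = gs.
Proof.
move=> sf nf sg ng e cs cn; apply/eqP; rewrite -subr_eq0; apply/eqP.
apply: semisimple_nilpotent0; first exact: semisimpleB.
have -> : fs - gs = gn - fn.
  by apply/eqP; rewrite subr_eq addrAC (addrC gn) -e addrK.
by apply: nilpotentB => // v; rewrite cn.
Qed.

Lemma nilpotent_comp_trace f g : nilpotent_end f -> (forall v, f (g v) = g (f v)) ->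
  end_trace (f \o g)%VF = 0.
Proof.
move=> [k fk] c.
suff : \tr (cplx_mx (f \o g)%VF) = 0.
  by rewrite cplx_mx_trace => /eqP; rewrite (fmorph_eq0 (real_complex R)) => /eqP.
apply: (@mxtrace_nilpotent_iter _ _ _ k).
have lin := iter_mulmx_linear (cplx_mx (f \o g)%VF) k.
apply: cplx_rv_ind => [v|x y hx hy|z x hx].
- rewrite -cplx_rv_iter.
  have -> : iter k (f \o g)%VF v = iter k f (iter k g v).
    by elim: (k) => //= m ->; rewrite comp_lfunE -iter_commute.
  by rewrite fk cplx_rv0.
- by have := lin 1 x y; rewrite !scale1r hx hy addr0.
- have l0 : iter k (fun x : 'rV_(\dim {:V}) => x *m cplx_mx (f \o g)%VF) 0 = 0.
    by elim: (k) => //= m ->; rewrite mul0mx.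
  by have := lin z x 0; rewrite !addr0 hx scaler0 l0 addr0.
Qed.

End Endomorphisms.

(** * Symmetric pairs of Lie algebras *)

Section RealLieAlgebra.
Context {R : realType} {V : vectType R}.
Variable br : V -> V -> V.
Hypothesis br_linearl : forall y, linear (br^~ y).
Hypothesis br_linearr : forall x, linear (br x).
Hypothesis br_anti : forall x y, br x y = - br y x.
Hypothesis br_jacobi : forall x y z, br x (br y z) = br (br x y) z + br y (br x z).

Definition ad_end x : 'End(V) := linfun (br x).
Definition killing_form x y : R := end_trace (ad_end x \o ad_end y)%VF.

Lemma ad_endE x y : ad_end x y = br x y.
Proof. by rewrite /ad_end linfunE. Qed.

Lemma ad_end_linear : linear ad_end.
Proof.
move=> k x y; apply/lfunP => z; rewrite add_lfunE scale_lfunE !ad_endE.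
exact: br_linearl.
Qed.

Lemma ad_end_br x y :
  ad_end (br x y) = (ad_end x \o ad_end y)%VF - (ad_end y \o ad_end x)%VF.
Proof.
apply/lfunP => z; rewrite add_lfunE opp_lfunE !comp_lfunE !ad_endE br_jacobi.
by rewrite addrK.
Qed.

Lemma end_traceD (f g : 'End(V)) : end_trace (f + g) = end_trace f + end_trace g.
Proof. by rewrite /end_trace /end_mx linearD linearD. Qed.

Lemma end_traceZ k (f : 'End(V)) : end_trace (k *: f) = k * end_trace f.
Proof. by rewrite /end_trace /end_mx linearZ mxtraceZ. Qed.

Lemma end_traceB (f g : 'End(V)) : end_trace (f - g) = end_trace f - end_trace g.
Proof. by rewrite -scaleN1r end_traceD end_traceZ mulN1r. Qed.

Lemma end_traceC (f g : 'End(V)) : end_trace (f \o g)%VF = end_trace (g \o f)%VF.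
Proof.
rewrite /end_trace /end_mx !(mxof_comp (vbasis {:V}) (vbasis {:V}) (vbasisP {:V})).
exact: mxtrace_mulC.
Qed.

Lemma killingC x y : killing_form x y = killing_form y x.
Proof. exact: end_traceC. Qed.

Lemma killing_linearl y : linear_for *%R (killing_form^~ y).
Proof.
move=> k x z; rewrite /killing_form ad_end_linear comp_lfunDl -comp_lfunZl.
by rewrite end_traceD end_traceZ.
Qed.

Lemma killing_invariant x y z : killing_form (br x y) z = killing_form x (br y z).
Proof.
rewrite /killing_form !ad_end_br comp_lfunDl comp_lfunNl comp_lfunDr comp_lfunNr.
rewrite !end_traceB -!comp_lfunA; congr (_ - _).
by rewrite end_traceC -comp_lfunA.
Qed.

(** For an automorphism f, ad(f z) is the conjugate of ad z by f, and traces are invariant under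
    conjugation. *)
Lemma killing_aut (f g : 'End(V)) x y : cancel f g -> cancel g f ->
  (forall u v, f (br u v) = br (f u) (f v)) ->
  killing_form (f x) (f y) = killing_form x y.
Proof.
move=> fK gK f_br.
have ad_f z : ad_end (f z) = (f \o (ad_end z \o g))%VF.
  apply/lfunP => v; rewrite [LHS]ad_endE comp_lfunE [in RHS]comp_lfunE.
  by rewrite [ad_end z _]ad_endE f_br gK.
rewrite /killing_form !ad_f -comp_lfunA end_traceC; congr end_trace.
apply/lfunP => v; rewrite !comp_lfunE fK.
by congr (ad_end x _); rewrite fK.
Qed.

Section Semisimple.
Hypothesis killing_nondeg : forall x, (forall y, killing_form x y = 0) -> x = 0.
Variables (sig : 'End(V)) (X : V).
Hypothesis sigK : forall v, sig (sig v) = v.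
Hypothesis sig_br : forall x y, sig (br x y) = br (sig x) (sig y).
Hypothesis X_q : sig X = - X.
Hypothesis X_ker2 : forall z, sig z = z -> br X (br X z) = 0 -> br X z = 0.

Local Notation C := (R[i]).
Local Notation d := (\dim {:V}).

(** Complex-linear extension of [ad_end], that is, the adjoint representation of the complexified
    algebra. *)
Let AD (z : 'rV[C]_d) : 'M[C]_d := \sum_i z 0 i *: cplx_mx (ad_end (vbasis {:V})`_i).

Let AD_linear : linear AD.
Proof.
move=> k x y; rewrite /AD scaler_sumr -big_split /=.
by apply: eq_bigr => i _; rewrite !mxE scalerDl scalerA.
Qed.

Let ADL : {linear 'rV[C]_d -> 'M[C]_d} :=
  HB.pack AD (GRing.isLinear.Build _ _ _ _ _ AD_linear).

Let AD_real v : AD (cplx_rv v) = cplx_mx (ad_end v).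
Proof.
rewrite [v in RHS](coord_basis (vbasisP {:V}) (memvf v)).
pose adL : {linear V -> 'End(V)} := HB.pack ad_end (GRing.isLinear.Build _ _ _ _ _ ad_end_linear).
rewrite -[ad_end]/(adL : _ -> _) linear_sum.
have -> (I : finType) (F : I -> 'End(V)) : cplx_mx (\sum_i F i) = \sum_i cplx_mx (F i).
  apply: (big_morph _ (@cplx_mxD _ _)).
  by rewrite /cplx_mx /end_mx linear0 map_mx0.
apply: eq_bigr => i _; rewrite linearZ /= cplx_mxZ; congr (_ *: _).
by rewrite /cplx_rv !mxE.
Qed.

Let AD_br u v : cplx_rv v *m AD (cplx_rv u) = cplx_rv (br u v).
Proof. by rewrite AD_real -cplx_rv_app ad_endE. Qed.

Let ADD x y : AD (x + y) = AD x + AD y.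
Proof. exact: (linearD ADL). Qed.
Let ADZ k x : AD (k *: x) = k *: AD x.
Proof. by rewrite -[AD]/(ADL : _ -> _) linearZ. Qed.

(** Bracket identities extend to the complexification from real vectors. Nondegeneracy and the
    kernel condition are not identities; they are checked on real and imaginary parts separately,
    since the Killing form, [sig] and [ad X] are real. *)
Lemma ad_semisimple : semisimple_end (ad_end X).
Proof.
rewrite /semisimple_end -/(cplx_mx (ad_end X)) -AD_real.
apply: (@ad_diagonalizable_any _ _ ADL (cplx_mx sig)).
- by rewrite pnatr_eq0.
- move=> x y; rewrite /=; move: x; apply: cplx_rv_ind => [u|x x' h h'|k x h].
  + move: y; apply: cplx_rv_ind => [v|y y' h h'|k y h].
    * rewrite AD_br !AD_real ad_end_br cplx_mxB; congr (_ - _); exact: cplx_mx_comp.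
    * by rewrite !(mulmxDl, ADD, mulmxDr) h h' opprD addrACA.
    * by rewrite -!scalemxAl !ADZ h -scalemxAl -scalemxAr scalerBr.
  + by rewrite ADD mulmxDr !(ADD, mulmxDl, mulmxDr) h h' opprD addrACA.
  + by rewrite !ADZ -!scalemxAr -scalemxAl !ADZ h scalerBr.
- move=> x hx; have [u [w e]] := cplx_rv_ReIm x.
  have hz v : killing_form u v = 0 /\ killing_form w v = 0.
    have := hx (cplx_rv v); rewrite e /= ADD ADZ !AD_real mulmxDl -scalemxAl.
    rewrite linearD /= mxtraceZ.
    rewrite -!cplx_mx_comp !cplx_mx_trace => /eqP.
    rewrite eq_complex /= !mul0r !mul1r ?subr0 ?addr0 ?add0r => /andP[/eqP e1 /eqP e2].
    by rewrite ![killing_form _ v]killingC.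
  rewrite e (killing_nondeg (fun v => (hz v).1)) (killing_nondeg (fun v => (hz v).2)).
  by rewrite cplx_rv0 scaler0 addr0.
- rewrite -cplx_mx_comp -cplx_mx1; congr cplx_mx; apply/lfunP => v.
  by rewrite comp_lfunE sigK id_lfunE.
- move=> x y; rewrite /=; move: x; apply: cplx_rv_ind => [u|x x' h h'|k x h].
  + move: y; apply: cplx_rv_ind => [v|y y' h h'|k y h].
    * by rewrite AD_br -!cplx_rv_app AD_br sig_br.
    * by rewrite !mulmxDl h h'.
    * by rewrite -!scalemxAl h.
  + by rewrite (mulmxDl x) !ADD !(mulmxDr, mulmxDl) h h'.
  + by rewrite -(scalemxAl k x) !ADZ -!scalemxAr -scalemxAl h.
- by rewrite -cplx_rv_app X_q cplx_rvN.
move=> z; rewrite /=; have [u [w ->]] := cplx_rv_ReIm z => hs hk.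
have := hs; rewrite mulmxDl -scalemxAl -!cplx_rv_app => /eqP.
rewrite -subr_eq0 opprD addrACA -scalerBr -!cplx_rvN -!cplx_rvD => /eqP/cplx_rv_ReIm0[su sw].
move: hk; rewrite !mulmxDl -!scalemxAl !AD_br => /cplx_rv_ReIm0[ku kw].
have {}su : sig u = u by apply/eqP; rewrite -subr_eq0 su.
have {}sw : sig w = w by apply/eqP; rewrite -subr_eq0 sw.
by rewrite (X_ker2 su ku) (X_ker2 sw kw) cplx_rv0 scaler0 addr0.
Qed.

End Semisimple.
End RealLieAlgebra.

Section SymmetricPairAlgebra.
Context {R : realType} {V : vectType R}.
Variable br : V -> V -> V.
Hypothesis br_linearl : forall y, linear (br^~ y).
Hypothesis br_linearr : forall x, linear (br x).
Hypothesis br_anti : forall x y, br x y = - br y x.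
Hypothesis br_jacobi : forall x y z, br x (br y z) = br (br x y) z + br y (br x z).
Hypothesis killing_nondeg : forall x, (forall y, killing_form br x y = 0) -> x = 0.
Variable sig : 'End(V).
Hypothesis sigK : forall v, sig (sig v) = v.
Hypothesis sig_br : forall x y, sig (br x y) = br (sig x) (sig y).
Local Notation B := (killing_form br).
Local Notation ad := (ad_end br).

Let brDl x y z : br (x + y) z = br x z + br y z.
Proof. by have := br_linearl z 1 x y; rewrite !scale1r. Qed.
Let br0l z : br 0 z = 0.
Proof. by apply: (addrI (br 0 z)); rewrite -brDl !addr0. Qed.
Let brZl k x z : br (k *: x) z = k *: br x z.
Proof. by have := br_linearl z k x 0; rewrite br0l !addr0. Qed.
Let brNl x z : br (- x) z = - br x z.
Proof. by rewrite -scaleN1r brZl scaleN1r. Qed.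
Let brNr x z : br x (- z) = - br x z.
Proof. by rewrite br_anti brNl -br_anti. Qed.
Let brDr x y z : br x (y + z) = br x y + br x z.
Proof. by rewrite br_anti brDl opprD -!(br_anti x). Qed.
Let brZr k x z : br x (k *: z) = k *: br x z.
Proof. by rewrite br_anti brZl -scalerN -br_anti. Qed.
Let br_same x : br x x = 0.
Proof.
have /eqP := br_anti x x; rewrite -addr_eq0 -mulr2n -scaler_nat scaler_eq0.
by rewrite pnatr_eq0 /= => /eqP.
Qed.

Let adE x y : ad x y = br x y := ad_endE br_linearr x y.

Lemma ad_end_inj x y : ad x = ad y -> x = y.
Proof.
move=> xy; apply/eqP; rewrite -subr_eq0; apply/eqP/killing_nondeg => z.
rewrite /killing_form; have -> : ad (x - y) = 0.
  apply/lfunP => w; rewrite zero_lfunE adE brDl brNl -!adE xy.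
  exact: subrr.
by rewrite comp_lfun0l /end_trace /end_mx linear0 linear0.
Qed.

Let ad0 : ad 0 = 0.
Proof. by apply/lfunP => w; rewrite zero_lfunE adE br0l. Qed.

Lemma br_commute x y : br x y = 0 -> forall z, br x (br y z) = br y (br x z).
Proof. by move=> xy z; rewrite br_jacobi xy br0l add0r. Qed.

Section JordanChevalley.
Variables y ys yn : V.
Hypothesis y_sum : y = ys + yn.
Hypothesis ys_ss : semisimple_end (ad ys).
Hypothesis yn_nil : nilpotent_end (ad yn).
Hypothesis ys_yn : br ys yn = 0.

Lemma jordan_centralizer z : br y z = 0 -> br ys z = 0 /\ br yn z = 0.
Proof.
move=> yz; have [] := @jordan_ker _ _ (ad ys) (ad yn) z ys_ss yn_nil.
- by move=> v; rewrite !adE br_commute.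
- by rewrite add_lfunE !adE -brDl -y_sum.
by rewrite !adE.
Qed.

Lemma semisimple_ad_sig x : semisimple_end (ad x) -> semisimple_end (ad (sig x)).
Proof.
move=> sx; apply: (@diagonalizable_restrict _ _ _ _ (cplx_mx (ad x)) (cplx_mx sig)) => //.
  apply/row_freeP; exists (cplx_mx sig); rewrite -cplx_mx_comp -cplx_mx1.
  by congr cplx_mx; apply/lfunP => v; rewrite comp_lfunE sigK id_lfunE.
rewrite -[map_mx _ _]/(cplx_mx (ad (sig x))).
apply: etrans (esym (cplx_mx_comp _ _)) _; apply: etrans _ (cplx_mx_comp _ _).
congr cplx_mx; apply/lfunP => v.
by rewrite !comp_lfunE !adE sig_br sigK.
Qed.

Lemma nilpotent_ad_sig x : nilpotent_end (ad x) -> nilpotent_end (ad (sig x)).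
Proof.
move=> [k xk]; exists k => v.
have -> : iter k (ad (sig x)) v = sig (iter k (ad x) (sig v)).
  elim: (k) => [|m /= ->]; first by rewrite /= sigK.
  by rewrite !adE sig_br.
by rewrite xk linear0.
Qed.

Lemma semisimpleN (f : 'End(V)) : semisimple_end f -> semisimple_end (- f).
Proof.
move=> sf; have s0 : semisimple_end (0 : 'End(V)).
  by rewrite /semisimple_end /end_mx linear0 map_mx0; exact: diagonalizable0.
rewrite -[- f]sub0r; apply: (semisimpleB s0 sf).
by move=> v; rewrite !zero_lfunE linear0.
Qed.

Lemma nilpotentN (f : 'End(V)) : nilpotent_end f -> nilpotent_end (- f).
Proof.
move=> nf; have n0 : nilpotent_end (0 : 'End(V)).
  by exists 1%N => v; rewrite /= zero_lfunE.
rewrite -[- f]sub0r; apply: (nilpotentB n0 nf).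
by move=> v; rewrite !zero_lfunE linear0.
Qed.

Let adN x : ad (- x) = - ad x.
Proof. by apply/lfunP => v; rewrite opp_lfunE !adE brNl. Qed.

(** Applying - sig to y = ys + yn gives another Jordan decomposition of y. Uniqueness asks that its
    parts commute with ys and yn: sig ys and sig yn centralize y, hence also ys and yn by
    [jordan_centralizer]. *)
Lemma jordan_q : sig y = - y -> sig ys = - ys /\ sig yn = - yn.
Proof.
move=> yq.
have y0 z : br y z = 0 -> br y (sig z) = 0.
  by move=> yz; rewrite -[y]opprK -yq brNl -sig_br yz linear0 oppr0.
have ys0 : br y ys = 0 by rewrite y_sum brDl br_same (br_anti yn) ys_yn oppr0 addr0.
have yn0 : br y yn = 0 by rewrite y_sum brDl br_same ys_yn addr0.
have [c1 _] := jordan_centralizer (y0 _ ys0).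
have [_ c2] := jordan_centralizer (y0 _ yn0).
have e : ys = - sig ys.
  apply: ad_end_inj; rewrite adN.
  have h1 := semisimpleN (semisimple_ad_sig ys_ss).
  have h2 := nilpotentN (nilpotent_ad_sig yn_nil).
  apply: (jordan_unique ys_ss yn_nil h1 h2).
  - rewrite -!adN; apply/lfunP => v; rewrite !add_lfunE !adE -!brDl.
    have -> : - sig ys - sig yn = - sig y by rewrite y_sum linearD opprD.
    by rewrite -y_sum yq opprK.
  - by move=> v; rewrite !opp_lfunE linearN /= !adE br_commute.
  - by move=> v; rewrite !opp_lfunE linearN /= !adE br_commute.
have es : sig ys = - ys by rewrite {2}e opprK.
split=> //; apply: (addrI (sig ys)).
have -> : sig ys + sig yn = sig y by rewrite y_sum linearD.
by rewrite yq y_sum opprD es.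
Qed.

(** [ad yn] is nilpotent and commutes with [ad z], so the trace of their product is 0; the value at
    ys follows by difference. *)
Lemma jordan_killing z : br y z = 0 -> B y z = 0 -> B ys z = 0 /\ B yn z = 0.
Proof.
move=> yz Byz; have [_ cn] := jordan_centralizer yz.
have Bn : B yn z = 0.
  by apply: nilpotent_comp_trace => // v; rewrite !adE br_commute.
split=> //; have := killing_linearl br_linearl br_linearr z 1 ys yn.
by rewrite scale1r -y_sum Byz Bn mul1r addr0 => <-.
Qed.

End JordanChevalley.

(** * The tangent space of the orbit and the algebraic shape operator *)

Section Tangent.
Variables (X : V) (T : {vspace V}).
Hypothesis X_q : sig X = - X.
Hypothesis memT : forall v, v \in T <-> exists2 Z, sig Z = Z & v = br Z X.
Hypothesis T_nondeg : forall v, v \in T ->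
  (forall w, w \in T -> B v w = 0) -> v = 0.
Local Notation D := (ad X).

(** By invariance, [z, X] pairs with [W, X] as W pairs with [X, [z, X]] = 0, so it is a tangent
    vector orthogonal to the whole tangent space. *)
Let X_ker2 z : sig z = z -> br X (br X z) = 0 -> br X z = 0.
Proof.
move=> zh Xz; apply/eqP; rewrite -oppr_eq0 -br_anti; apply/eqP.
apply: T_nondeg; first by apply/memT; exists z.
move=> w /memT[W Wh ->]; rewrite killingC killing_invariant//.
by rewrite (br_anti z) brNr Xz oppr0 killingC /killing_form ad0
    comp_lfun0l /end_trace /end_mx !linear0.
Qed.


Lemma adX_semisimple : semisimple_end D.
Proof.
exact: (ad_semisimple br_linearl br_linearr br_jacobi killing_nondeg sigK
          sig_br X_q X_ker2).
Qed.

Let D_ker2 t : D (D t) = 0 -> D t = 0.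
Proof. by move=> h; apply: (semisimple_iter_ker (k := 2) adX_semisimple). Qed.

(** D and D^2 have the same kernel, hence the same rank, and the image of D^2 lies in that of D. *)
Let D_im z : exists t, D z = D (D t).
Proof.
have kE : lker (D \o D)%VF = lker D.
  apply/vspaceP => v; rewrite !memv_ker comp_lfunE.
  by apply/eqP/eqP => [/D_ker2|->] //; rewrite linear0.
have : (limg (D \o D)%VF == limg D).
  rewrite eqEdim limg_comp limgS ?subvf//=.
  have := limg_ker_dim (D \o D)%VF fullv; have := limg_ker_dim D fullv.
  by rewrite kE limg_comp => <- /eqP; rewrite eqn_add2l => /eqP ->.
move=> /eqP im; have : D z \in limg (D \o D)%VF by rewrite im memv_img ?memvf.
by move=> /memv_imgP[t _ ->]; exists t; rewrite comp_lfunE.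
Qed.

Let D_im_iter m z : exists t, D z = iter m.+1 D t.
Proof.
elim: m z => [|m IH] z; first by exists z.
by have [t zt] := D_im z; have [t' tt'] := IH t; exists t'; rewrite zt tt' /=.
Qed.

Let T_D v : v \in T -> exists z, v = D z.
Proof. by move=> /memT[Z _ ->]; exists (- Z); rewrite adE brNr -br_anti. Qed.

Let T_q v : v \in T -> sig v = - v.
Proof. by move=> /memT[Z Zh ->]; rewrite sig_br Zh X_q brNr. Qed.

Let T_iter m v : v \in T -> exists t, v = iter m D t.
Proof.
case: m => [|m] vT; first by exists v.
by have [z ->] := T_D vT; exact: D_im_iter.
Qed.

(** [(D \o D)^-1%VF] is a section of D^2 over its image, which contains [T]. For normal [y] the
    vector under [vsproj] is already in [T], as [shape_endE] shows; the projection provides the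
    type. *)
Definition shape_end (y : V) : 'End(subvs_of T) :=
  linfun (fun v : subvs_of T => vsproj T (- br y (D ((D \o D)^-1%VF (vsval v))))).

Section Normal.
Variable y : V.
Hypothesis y_q : sig y = - y.
Hypothesis yX : br y X = 0.

Let yD z : br y (D z) = D (br y z).
Proof. by rewrite !adE br_commute. Qed.

Lemma shape_endE (v : subvs_of T) t : D (D t) = vsval v ->
  vsval (shape_end y v) = - br y (D t).
Proof.
move=> tv; rewrite /shape_end linfunE; last first.
  move=> k u w.
  have -> : vsval (k *: u + w) = k *: vsval u + vsval w by rewrite linearP.
  by rewrite (linearP (D \o D)^-1%VF) (linearP D) brDr brZr opprD -scalerN linearP.
set t' := (_^-1)%VF _.
have t'v : D (D t') = vsval v.
  have := limg_lfunVK (f := (D \o D)%VF) (x := vsval v); rewrite comp_lfunE; apply.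
  by rewrite -tv -[D (D t)](comp_lfunE D D) memv_img ?memvf.
(* [D s] depends only on D^2 s, so the chosen preimage may be replaced by any other. *)
have E s s' : D (D s) = vsval v -> D (D s') = vsval v -> D s = D s'.
  move=> h h'; apply/eqP; rewrite -subr_eq0 -linearB; apply/eqP/D_ker2.
  by rewrite !linearB /= h h' subrr.
rewrite (E t' t t'v tv) vsprojK//.
(* The component of [t] in q is also a preimage of [v], since [v] is in q. Then [y, D tq] = D
   [y, tq] with [y, tq] in h, a bracket of two elements of q, and the value is tangent. *)
pose tq := 2^-1 *: (t - sig t).
have sD z : sig (D z) = - D (sig z) by rewrite !adE sig_br X_q brNl.
have tqv : D (D tq) = vsval v.
  rewrite /tq !linearZ !linearB /= tv.
  have -> : D (D (sig t)) = - vsval v.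
    by rewrite -(T_q (subvsP v)) -tv !sD linearN opprK.
  by rewrite opprK -mulr2n -(scaler_nat 2 (vsval v)) scalerA mulVf ?scale1r// pnatr_eq0.
rewrite (E t tq tv tqv) yD adE -br_anti; apply/memT; exists (br y tq) => //.
rewrite sig_br y_q /tq linearZ linearB /= sigK brNl -brNr; congr br.
by rewrite -scalerN opprB.
Qed.

(* Weingarten's formula for a normal field obtained from [y] by the action of
   the isotropy group. *)
Lemma shape_end_killing (v : subvs_of T) W : sig W = W ->
  B (vsval (shape_end y v)) (br W X) = - B W (br y (vsval v)).
Proof.
move=> Wh; have [t /= vt] := T_iter 2 (subvsP v).
rewrite (shape_endE (esym vt)) vt.
have -> : B (- br y (D t)) (br W X) = - B (br y (D t)) (br W X).
  have := killing_linearl br_linearl br_linearr (br W X) (-1) (br y (D t)) 0.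
  by rewrite scaleN1r mulN1r addr0 /killing_form ad0 comp_lfun0l /end_trace /end_mx !linear0 addr0.
congr (- _); rewrite killingC killing_invariant//; congr killing_form.
by rewrite -adE -yD.
Qed.

End Normal.

(** Over the complex numbers let K satisfy D^2 K = D (ad y) as row operators. On vectors D^2 t of T
    the shape operator is then the restriction of - K, transported by the inclusion [J]. *)
Lemma shape_end_semisimple y : sig y = - y -> br y X = 0 ->
  semisimple_end (ad y) -> semisimple_end (shape_end y).
Proof.
move=> yq yX yss.
have c : cplx_mx D *m cplx_mx (ad y) = cplx_mx (ad y) *m cplx_mx D.
  apply: etrans (esym (cplx_mx_comp _ _)) _; apply: etrans _ (cplx_mx_comp _ _).
  by congr cplx_mx; apply/lfunP => v; rewrite !comp_lfunE !adE br_commute.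
have [K dK hK] := diagonalizable_quotient adX_semisimple yss c.
have d0 : diagonalizable (0 : 'M[R[i]]_(\dim {:V})) := diagonalizable0 _.
have dNK : diagonalizable (- K).
  by rewrite -[- K]sub0r; apply: (diagonalizableB d0 dK); rewrite mulmx0 mul0mx.
pose J : 'M[R[i]]_(\dim {:subvs_of T}, \dim {:V}) :=
  map_mx (real_complex R) (mxof (vbasis {:subvs_of T}) (vbasis {:V}) (linfun vsval)).
have JE (u : subvs_of T) : cplx_rv u *m J = cplx_rv (vsval u).
  rewrite /J -map_mxM; congr map_mx; rewrite -[in RHS](lfunE vsval u).
  by rewrite (rVof_app _ (vbasisP _)).
apply: (diagonalizable_restrict (J := J) _ _ dNK).
  rewrite -kermx_eq0; apply/rowV0P => z /sub_kermxP zJ.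
  have [u [w e]] := cplx_rv_ReIm z.
  move: zJ; rewrite e mulmxDl -scalemxAl !JE => /cplx_rv_ReIm0[hu hw].
  have -> : u = 0 by apply: val_inj.
  have -> : w = 0 by apply: val_inj.
  by rewrite cplx_rv0 scaler0 addr0.
rewrite -[map_mx _ _]/(cplx_mx (shape_end y)).
apply/row_matrixP => i; rewrite !rowE -cplx_rv_basis; set u := _`_i.
rewrite !mulmxA JE -cplx_rv_app JE.
have [t /= ut] := T_iter 2 (subvsP u).
rewrite (shape_endE yq yX (esym ut)) cplx_rvN ut mulmxN; congr (- _).
by rewrite -adE !cplx_rv_app -!mulmxA -hK !mulmxA.
Qed.

Lemma shape_end_nilpotent y : sig y = - y -> br y X = 0 ->
  nilpotent_end (ad y) -> nilpotent_end (shape_end y).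
Proof.
move=> yq yX [k yk]; exists k => v; apply: val_inj.
(* The operator sends D^(2m+2) u to D^(2m) (- [y, D u]): of the two factors D that a step takes off,
   one is absorbed into the new u. *)
have step m (w : subvs_of T) u : vsval w = iter (2 * m) D u ->
    vsval (iter m (shape_end y) w) = (-1) ^+ m *: iter m (ad y) (iter m D u).
  elim: m w u => [|m IH] w u wu; first by rewrite expr0 scale1r.
  have c z : ad y (D z) = D (ad y z) by rewrite !adE br_commute.
  have w' : vsval (shape_end y w) = iter (2 * m) D (- ad y (D u)).
    rewrite (shape_endE (t := iter (2 * m) D u) yq yX); last by rewrite wu mulnS.
    by rewrite iter_lfunN -adE (iter_commute (f := D)) -?iterSr// => z; rewrite c.
  rewrite iterSr (IH _ _ w') !iter_lfunN scalerN -scaleNr -mulN1r -exprS; congr (_ *: _).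
  by rewrite (iter_commute (f := D)) -?iterSr// => z; rewrite c.
have [u vu] := T_iter (2 * k) (subvsP v).
by have := step k v u vu; rewrite yk scaler0 => h; apply: etrans h _.
Qed.

(** Writing v = D^4 u, the composite in either order is the iterated bracket of D^2 u with y and z,
    and ad y commutes with ad z. *)
Lemma shape_end_commute y z : sig y = - y -> br y X = 0 ->
  sig z = - z -> br z X = 0 -> br y z = 0 ->
  (shape_end y \o shape_end z = shape_end z \o shape_end y)%VF.
Proof.
move=> yq yX zq zX yz.
have half a b (v : subvs_of T) u : sig a = - a -> br a X = 0 ->
    sig b = - b -> br b X = 0 -> vsval v = iter 4 D u ->
    vsval (shape_end a (shape_end b v)) = br a (br b (D (D u))).
  move=> aq aX bq bX vu.
  have ca w : br a (D w) = D (br a w) by rewrite !adE br_commute.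
  have cb w : br b (D w) = D (br b w) by rewrite !adE br_commute.
  have h : vsval (shape_end b v) = D (D (- br b (D u))).
    by rewrite (shape_endE (t := D (D u)) bq bX (esym vu)) !linearN /= -!cb.
  by rewrite (shape_endE (t := - br b (D u)) aq aX (esym h)) linearN brNr opprK /= -cb.
apply/lfunP => v; rewrite !comp_lfunE; apply: val_inj.
have [u vu] := T_iter 4 (subvsP v).
apply: etrans (half y z v u yq yX zq zX vu) _.
by apply: etrans _ (esym (half z y v u zq zX yq yX vu)); rewrite br_commute.
Qed.

Lemma shape_endD y z : shape_end (y + z) = shape_end y + shape_end z.
Proof.
have lin a : linear (fun v : subvs_of T =>
    vsproj T (- br a (D ((D \o D)^-1%VF (vsval v))))).
  move=> k u w.
  have -> : vsval (k *: u + w) = k *: vsval u + vsval w by rewrite linearP.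
  by rewrite (linearP (D \o D)^-1%VF) (linearP D) brDr brZr opprD -scalerN linearP.
by apply/lfunP => v; rewrite add_lfunE /shape_end !linfunE// brDl opprD linearD.
Qed.

Theorem shape_end_jordan y ys yn : sig y = - y -> br y X = 0 ->
  y = ys + yn -> semisimple_end (ad ys) -> nilpotent_end (ad yn) -> br ys yn = 0 ->
  jordan_chevalley (shape_end y) (shape_end ys) (shape_end yn).
Proof.
move=> yq yX e ss nn c.
have [sX nX] := jordan_centralizer e ss nn c yX.
have [sq nq] := jordan_q e ss nn c yq.
split; first by rewrite e shape_endD.
- exact: shape_end_semisimple.
- exact: shape_end_nilpotent.
- exact: shape_end_commute.
Qed.

End Tangent.
End SymmetricPairAlgebra.

(** * Differential calculus in finite dimension *)

Local Open Scope classical_set_scope.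
Local Open Scope ring_scope.

Section Norms.
Context {R : realType} {n : nat}.
Implicit Types v : 'rV[R]_n.

Lemma rV_norm_leP v (c : R) : 0 <= c ->
  `|v| <= c <-> forall i, `|v 0 i| <= c.
Proof.
move=> c0; rewrite /Num.norm/= mx_normrE; split.
  move=> /bigmax_leP[_ h] i; exact: (h (0, i)).
move=> h; apply/bigmax_leP; split=> // -[i j] _ /=; rewrite (ord1 i); exact: h.
Qed.

Lemma rV_norm_coord v i : `|v 0 i| <= `|v|.
Proof. by have [h _] := rV_norm_leP v (normr_ge0 v); apply: h. Qed.

End Norms.

(** * From directional derivatives to strict differentiability *)

Section MeanValue.
Context {R : realType} {V : normedModType R}.
Implicit Types (f : V -> R) (x v : V).

Lemma derivable_line f x v s : derivable f (x + s *: v) v ->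
  is_derive s 1 (fun t : R => f (x + t *: v)) ('D_v f (x + s *: v)).
Proof.
move=> df.
have e : (fun h : R => h^-1 *: (((fun t : R => f (x + t *: v)) \o shift s) (h *: 1) -
            f (x + s *: v))) =
         (fun h : R => h^-1 *: ((f \o shift (x + s *: v)) (h *: v) - f (x + s *: v))).
  apply/funext => h /=; congr (_ *: (f _ - _)).
  by rewrite [h%:A]mulr1 scalerDl addrCA.
by split; rewrite /derivable /derive e.
Qed.

Lemma mean_value_line f x v (k : R) :
  (forall t : R, 0 <= t <= 1 -> derivable f (x + (t * k) *: v) v) ->
  exists2 t : R, 0 <= t <= 1 &
    f (x + k *: v) - f x = k * 'D_v f (x + (t * k) *: v).
Proof.
move=> df; pose g (t : R) := f (x + (t * k) *: v).
have dg (t : R) : t \in `[0, 1] ->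
    is_derive t 1 g ('D_v f (x + (t * k) *: v) * k).
  rewrite in_itv/= => /df/derivable_line h.
  apply: (is_derive1_comp (f := fun s : R => f (x + s *: v)) (g := *%R^~ k) h).
  have -> : *%R^~ k = k *: (id : R -> R).
    by apply/funext => s; rewrite mulrC.
  by apply: is_derive_eq; rewrite [_ *: _]mulr1.
have [t] := MVT_segment (f := g) ler01
  (fun s hs => dg s (subset_itv_oo_cc hs)) (derivable_within_continuous
     (fun s hs => @ex_derive _ _ _ _ _ _ _ (dg s hs))).
rewrite in_itv/= /g mul1r mul0r scale0r addr0 subr0 mulr1 => ht e.
by exists t; rewrite // mulrC.
Qed.

End MeanValue.

Section StrictDifferential.
Context {R : realType} {n : nat}.
Implicit Types (f : 'rV[R]_n -> R) (x y v : 'rV[R]_n).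

Local Notation e_ i := (delta_mx (0 : 'I_1) i : 'rV[R]_n).

Definition head_sum v k : 'rV[R]_n := \row_i (if (i < k)%N then v 0 i else 0).

Lemma head_sum0 v : head_sum v 0 = 0.
Proof. by apply/rowP => i; rewrite !mxE. Qed.

Lemma head_sumn v : head_sum v n = v.
Proof. by apply/rowP => i; rewrite !mxE ltn_ord. Qed.

Lemma head_sumS v (k : 'I_n) : head_sum v k.+1 = head_sum v k + v 0 k *: e_ k.
Proof.
apply/rowP => i; rewrite !mxE eqxx /= ltnS leq_eqVlt.
have [->|ik] := eqVneq i k; first by rewrite eqxx ltnn /= mulr1 add0r.
by rewrite -[(i == k :> nat)]/(i == k) (negbTE ik) /= mulr0 addr0.
Qed.

(** Go from x to y along the axes, through the points [x + head_sum v k], and apply the mean value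
    theorem on each leg. *)
Lemma strict_increment f x0 (d ep : R) : 0 <= ep ->
  (forall z, `|z - x0| < d -> forall i,
     derivable f z (e_ i) /\ `|'D_(e_ i) f z - 'D_(e_ i) f x0| <= ep) ->
  forall x y, `|x - x0| < d -> `|y - x0| < d ->
  `|f y - f x - \sum_i (y - x) 0 i * 'D_(e_ i) f x0| <= (n%:R * ep) * `|y - x|.
Proof.
move=> ep0 df x y xd yd; set v := y - x.
(* The norm is the sup norm and each coordinate of an intermediate point lies between those of x and
   y, so the path does not leave the ball. *)
have inb (k : 'I_n) (t : R) : 0 <= t <= 1 ->
    `|x + head_sum v k + (t * v 0 k) *: e_ k - x0| < d.
  move=> /andP[t0 t1].
  have [m [m0 md xm ym]] :
      exists m, [/\ 0 <= m, m < d, `|x - x0| <= m & `|y - x0| <= m].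
    exists (Num.max `|x - x0| `|y - x0|); split.
    - by rewrite le_max normr_ge0.
    - by rewrite gt_max xd yd.
    - by rewrite le_max lexx.
    - by rewrite le_max lexx orbT.
  apply: le_lt_trans md; apply/rV_norm_leP => // i.
  have := le_trans (rV_norm_coord _ i) xm; have := le_trans (rV_norm_coord _ i) ym.
  rewrite /v !mxE eqxx /=.
  have [->|ik] := eqVneq i k; last first.
    by case: ifP => _ hy hx; rewrite mulr0 addr0 ?addr0// addrC subrKC addrC.
  rewrite ltnn addr0 /= mulr1.
  move: (x 0 k) (y 0 k) (x0 0 k) => a b c.
  have -> : a + t * (b - a) - c = (1 - t) * (a - c) + t * (b - c) by ring.
  move=> hb ha; rewrite (le_trans (ler_normD _ _))// !normrM.
  rewrite (ger0_norm t0) ger0_norm ?subr_ge0//.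
  have -> : m = (1 - t) * m + t * m by ring.
  by rewrite lerD// ler_wpM2l// subr_ge0.
have step (k : 'I_n) :
    `|f (x + head_sum v k.+1) - f (x + head_sum v k) - v 0 k * 'D_(e_ k) f x0|
    <= ep * `|v|.
  have [t /(inb k)/df/(_ k)[_ ht]] := @mean_value_line _ _ f (x + head_sum v k) (e_ k) (v 0 k)
    (fun t ht => (df _ (inb k t ht) k).1).
  rewrite -addrA -head_sumS => ->.
  rewrite -mulrBr normrM mulrC ler_pM//; exact: rV_norm_coord.
have -> : f y = f (x + head_sum v n) by rewrite head_sumn /v subrKC.
rewrite -[in f x](addr0 x) -[in f (x + 0)](head_sum0 v).
rewrite -(telescope_sumr (fun k => f (x + head_sum v k)))// big_mkord -sumrB.
rewrite (le_trans (ler_norm_sum _ _ _))//.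
rewrite (le_trans (ler_sum _ (fun k _ => step k)))//.
by rewrite sumr_const card_ord -mulrA mulr_natl.
Qed.

End StrictDifferential.

Section LinearMaps.
Context {R : realType} {n : nat} {W : normedModType R}.

Lemma linear_rVE (f : 'rV[R]_n -> W) : linear f ->
  f = \sum_i (fun v : 'rV[R]_n => v 0 i *: f (delta_mx 0 i)).
Proof.
move=> lf; pose fL : {linear 'rV[R]_n -> W} := HB.pack f (GRing.isLinear.Build _ _ _ _ _ lf).
apply/funext => v; rewrite fct_sumE -[f]/(fL : _ -> _) [in LHS](row_sum_delta v).
by rewrite linear_sum; apply: eq_bigr => i _; rewrite linearZ.
Qed.

Lemma linear_rV_differentiable (f : 'rV[R]_n -> W) x : linear f ->
  differentiable f x.
Proof.
move=> lf; rewrite (linear_rVE lf); apply: differentiable_sum => i.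
apply: differentiableZl; exact: differentiable_coord.
Qed.

Lemma derive_linear (V : normedModType R) (f : V -> W) x v : linear f ->
  is_derive x v f (f v).
Proof.
move=> lf; have e : (fun h : R => h^-1 *: ((f \o shift x) (h *: v) - f x)) @ 0^' --> f v.
  apply: cvg_near_cst; rewrite near_withinE; near=> h => h0 /=.
  by rewrite lf addrK scalerA mulVf// scale1r.
by split; [apply/cvg_ex; exists (f v)|apply/cvg_lim].
Unshelve. all: by end_near. Qed.

End LinearMaps.

Lemma differentiable_from_bound (R : realType) (V W : normedModType R)
    (f : V -> W) (x0 : V) (L : V -> W) : linear L -> continuous L ->
  (forall ep : R, 0 < ep -> exists2 d : R, 0 < d & forall v, `|v| < d ->
     `|f (v + x0) - f x0 - L v| <= ep * `|v|) ->
  differentiable f x0.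
Proof.
move=> lL cL hL.
pose LL : {linear V -> W} := HB.pack L (GRing.isLinear.Build _ _ _ _ _ lL).
have e : f \o shift x0 = cst (f x0) + (LL : V -> W) +o_ 0 id.
  apply/eqaddoP => ep ep0; have [d d0 hd] := hL ep ep0.
  apply/nbhs_ballP; exists d => // v; rewrite -ball_normE /= sub0r normrN => vd.
  by have := hd v vd; rewrite opprD addrA.
by apply/diff_locallyP; rewrite (diff_unique (df := LL) cL e).
Qed.

Section StrictVector.
Context {R : realType} {n m : nat}.
Implicit Types (f : 'rV[R]_n -> 'rV[R]_m) (x y v : 'rV[R]_n).

Local Notation e_ i := (delta_mx (0 : 'I_1) i : 'rV[R]_n).

Let L f x0 v := \sum_i v 0 i *: 'D_(e_ i) f x0.

Let L_linear f x0 : linear (L f x0).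
Proof.
move=> a u v; rewrite /L scaler_sumr -big_split /=.
by apply: eq_bigr => i _; rewrite !mxE scalerDl scalerA.
Qed.

Let strict f x0 :
  (\forall x \near x0, forall v, derivable f x v) ->
  (forall v, {for x0, continuous (fun x => 'D_v f x)}) ->
  forall ep : R, 0 < ep -> exists2 d : R, 0 < d &
  forall x y, `|x - x0| < d -> `|y - x0| < d ->
  `|f y - f x - L f x0 (y - x)| <= ep * `|y - x|.
Proof.
move=> df cf ep ep0.
(* The [n] coordinate errors add up to at most [ep]; [n.+1] keeps the divisor positive when n =
   0. *)
pose ep' := ep / n.+1%:R.
have ep'0 : 0 < ep' by rewrite divr_gt0.
have : \forall z \near x0, forall i : 'I_n, (forall v, derivable f z v) /\
      `|'D_(e_ i) f z - 'D_(e_ i) f x0| <= ep'.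
  near=> z; near: z; apply: filter_forall => i.
  near=> z; split; first by near: z.
  by rewrite distrC; near: z; have /cvgrPdist_le/(_ ep' ep'0) := cf (e_ i).
move=> /nbhs_ballP[d /= d0 hd].
exists d => // x y xd yd; apply/rV_norm_leP => [|j]; first by rewrite mulr_ge0// ltW.
have hd' z : `|z - x0| < d -> forall i,
     derivable (fun x => f x 0 j) z (e_ i) /\
     `|'D_(e_ i) (fun x => f x 0 j) z - 'D_(e_ i) (fun x => f x 0 j) x0| <= ep'.
  move=> zd i.
  have bz : ball x0 d z by rewrite -ball_normE /= distrC.
  have bx : ball x0 d x0 by rewrite -ball_normE /= subrr normr0.
  have [dz hz] := hd _ bz i; have [dx _] := hd _ bx i.
  split; first by have /derivable_mxP := dz (e_ i); apply.
  apply: le_trans hz; apply: le_trans (rV_norm_coord _ j).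
  by rewrite !derive_mx// !mxE.
have := strict_increment (ltW ep'0) hd' xd yd.
set A := `|_ - _ - \sum_i _|; set B := `|_ 0 j|.
have -> : A = B.
  rewrite /A /B !mxE /L summxE; congr (`|_ - _|); apply: eq_bigr => i _.
  have bx : ball x0 d x0 by rewrite -ball_normE /= subrr normr0.
  by rewrite !mxE derive_mx ?mxE//; apply: (hd _ bx i).1.
move=> /le_trans; apply; apply: ler_wpM2r; first exact: normr_ge0.
by rewrite /ep' mulrCA ger_pMr// ler_pdivrMr ?ltr0n// mul1r ler_nat.
Unshelve. all: by end_near. Qed.

Lemma C1_differentiable f x0 :
  (\forall x \near x0, forall v, derivable f x v) ->
  (forall v, {for x0, continuous (fun x => 'D_v f x)}) ->
  differentiable f x0.
Proof.
move=> df cf.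
apply: (differentiable_from_bound (L_linear f x0)).
  by move=> x; apply/differentiable_continuous/linear_rV_differentiable/L_linear.
move=> ep ep0; have [d d0 hd] := strict df cf ep0.
exists d => // v vd; have := hd x0 (v + x0).
by rewrite subrr normr0 addrK; apply.
Qed.

(** Two moving points instead of one: this form makes the remainder Lipschitz with a small constant,
    as [psi_small] requires. *)
Lemma C1_strict_differentiable f x0 :
  (\forall x \near x0, forall v, derivable f x v) ->
  (forall v, {for x0, continuous (fun x => 'D_v f x)}) ->
  forall ep : R, 0 < ep -> exists2 d : R, 0 < d &
  forall x y, `|x - x0| < d -> `|y - x0| < d ->
  `|f y - f x - 'D_(y - x) f x0| <= ep * `|y - x|.
Proof.
move=> df cf ep ep0; have [d d0 hd] := strict df cf ep0; exists d => // x y xd yd.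
have D := C1_differentiable df cf.
suff -> : 'D_(y - x) f x0 = L f x0 (y - x) by apply: hd.
rewrite deriveE// {1}(row_sum_delta (y - x)) linear_sum.
by apply: eq_bigr => i _; rewrite linearZ /= -deriveE.
Qed.

Lemma class_C1_differentiable f U x0 : class_C 1 f U -> nbhs x0 U ->
  differentiable f x0.
Proof.
move=> [df cf] Ux0; apply: C1_differentiable.
  by apply: filterS Ux0 => x Ux v; apply: df.
by move=> v; apply: cf; apply: nbhs_singleton Ux0.
Qed.

Lemma class_C1_strict f U x0 : class_C 1 f U -> nbhs x0 U ->
  forall ep : R, 0 < ep -> exists2 d : R, 0 < d &
  forall x y, `|x - x0| < d -> `|y - x0| < d ->
  `|f y - f x - 'D_(y - x) f x0| <= ep * `|y - x|.
Proof.
move=> [df cf] Ux0; apply: C1_strict_differentiable.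
  by apply: filterS Ux0 => x Ux v; apply: df.
by move=> v; apply: cf; apply: nbhs_singleton Ux0.
Qed.

End StrictVector.

Section ClassC.
Context {R : realType}.

Lemma derive_comp_linear (V' V W : normedModType R) (f : V -> W) (phi : V' -> V)
    x v : linear phi ->
  (derivable (f \o phi) x v <-> derivable f (phi x) (phi v)) /\
  'D_v (f \o phi) x = 'D_(phi v) f (phi x).
Proof.
move=> lp; rewrite /derivable /derive.
have -> : (fun h : R => h^-1 *: (((f \o phi) \o shift x) (h *: v) - (f \o phi) x)) =
          (fun h : R => h^-1 *: ((f \o shift (phi x)) (h *: phi v) - f (phi x))).
  by apply/funext => h /=; rewrite lp.
by [].
Qed.

Lemma class_C_comp_linear k (V' V W : normedModType R) (f : V -> W)
    (phi : V' -> V) U : linear phi -> continuous phi ->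
  class_C k f U -> class_C k (f \o phi) (phi @^-1` U).
Proof.
move=> lp cp; elim: k f => [|k IH] f /=.
  by move=> cf x Ux; apply: continuous_comp; [exact: cp|exact: cf].
move=> [df cf]; split=> [x v Ux|v].
  by apply/(derive_comp_linear f x v lp).1; apply: df.
have -> : (fun x => 'D_v (f \o phi) x) = (fun x => 'D_(phi v) f x) \o phi.
  by apply/funext => x; rewrite (derive_comp_linear f x v lp).2.
exact: IH.
Qed.

Lemma linear_continuous_differentiable (V W : normedModType R) (f : V -> W) x :
  linear f -> continuous f -> differentiable f x.
Proof.
move=> lf cf; pose fL : {linear V -> W} := HB.pack f (GRing.isLinear.Build _ _ _ _ _ lf).
exact: (linear_differentiable (f := fL)).
Qed.

(** The coordinate-wise argument is made for row vectors, so the product is identified with a single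
    row space by [row_mx]. *)
Lemma class_C1_pair_differentiable n m k (f : 'rV[R]_n * 'rV[R]_m -> 'rV[R]_k) U p :
  class_C 1 f U -> nbhs p U -> differentiable f p.
Proof.
move=> cf Up.
pose phi (z : 'rV[R]_(n + m)) := (lsubmx z, rsubmx z).
pose psi (q : 'rV[R]_n * 'rV[R]_m) := row_mx q.1 q.2.
have psiK : cancel psi phi by move=> [a b]; rewrite /phi row_mxKl row_mxKr.
have lphi : linear phi by move=> a u v; rewrite /phi !linearP.
have cphi : continuous phi.
  move=> z; apply: (@cvg_pair _ _ _ (nbhs z) (nbhs (lsubmx z)) (nbhs (rsubmx z))).
    exact: continuous_lsubmx.
  exact: continuous_rsubmx.
have dpsi : differentiable psi p.
  have -> : psi = (fun q => row_mx q.1 0 : 'rV[R]_(n + m)) +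
                  (fun q => row_mx 0 q.2 : 'rV[R]_(n + m)).
    by apply/funext => -[a b]; rewrite /psi /= fctE /= add_row_mx addr0 add0r.
  have d1 : differentiable (fun q : 'rV[R]_n * 'rV[R]_m => row_mx q.1 0 : 'rV[R]_(n + m)) p.
    apply: (differentiable_comp (f := fst) (g := fun a => row_mx a 0 : 'rV[R]_(n + m))).
      by apply: linear_continuous_differentiable => // q; exact: cvg_fst.
    by apply: linear_rV_differentiable => a u v;
      rewrite scale_row_mx add_row_mx scaler0 addr0.
  have d2 : differentiable (fun q : 'rV[R]_n * 'rV[R]_m => row_mx 0 q.2 : 'rV[R]_(n + m)) p.
    apply: (differentiable_comp (f := snd) (g := fun a => row_mx 0 a : 'rV[R]_(n + m))).
      by apply: linear_continuous_differentiable => // q; exact: cvg_snd.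
    by apply: linear_rV_differentiable => a u v;
      rewrite scale_row_mx add_row_mx scaler0 addr0.
  exact: (differentiableD d1 d2).
have -> : f = (f \o phi) \o psi by apply/funext => q /=; rewrite psiK.
apply: differentiable_comp => //.
apply: (class_C1_differentiable (class_C_comp_linear lphi cphi cf)).
by apply: cphi; rewrite psiK.
Qed.

Lemma differentiable_bound (V W : normedModType R) (g : V -> W) x :
  differentiable g x -> forall ep : R, 0 < ep -> exists2 d : R, 0 < d &
  forall w, `|w| < d -> `|g (w + x) - g x - 'd g x w| <= ep * `|w|.
Proof.
move=> /diff_locally/eqaddoP h ep ep0.
have /nbhs_ballP[d /= d0 hd] := h ep ep0; exists d => // w wd.
have := hd w; rewrite -ball_normE /= sub0r normrN => /(_ wd).
by rewrite opprD addrA.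
Qed.

Lemma is_derive_shift_arg (V W : normedModType R) (f : V -> W) y w u :
  derivable f (y + w) u -> is_derive y u (fun z => f (z + w)) ('D_u f (y + w)).
Proof.
move=> df.
have e : (fun h : R => h^-1 *: (((fun z => f (z + w)) \o shift y) (h *: u) - f (y + w)))
   = (fun h : R => h^-1 *: ((f \o shift (y + w)) (h *: u) - f (y + w))).
  by apply/funext => h /=; rewrite addrA.
by split; rewrite /derivable /derive e.
Qed.

(** * Symmetry of second derivatives *)

Section Schwarz.
Context {V : normedModType R}.

(** The mean value theorem along u for y |-> f(y + hv) - f(y) turns the second difference into h
    times a difference of values of D_u f, which differentiability of D_u f at x evaluates. *)
Let second_difference (f : V -> R) x u v :
  (\forall y \near x, derivable f y u) ->
  differentiable (fun y => 'D_u f y) x ->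
  forall ep : R, 0 < ep -> exists2 d : R, 0 < d & forall h : R, 0 < h < d ->
  `|f (x + h *: u + h *: v) - f (x + h *: u) - (f (x + h *: v) - f x)
    - h ^+ 2 * 'D_v (fun y => 'D_u f y) x| <= ep * h ^+ 2.
Proof.
move=> /nbhs_ballP[d1 /= d10 df] dG ep ep0.
set G := fun y => 'D_u f y.
(* All displacements below have norm at most h M, and M > 0 even if u = v = 0. The bound ep / (M +
   M) leaves half of the error to each of the two values of [G]. *)
set M := `|u| + `|v| + 1.
have M0 : 0 < M by rewrite ltr_wpDl// addr_ge0.
have ep'0 : 0 < ep / (M + M) by rewrite divr_gt0// addr_gt0.
have [d2 d20 hG] := differentiable_bound dG ep'0.
exists (Num.min d1 d2 / M) => [|h /andP[h0]].
  by rewrite divr_gt0// lt_min d10.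
rewrite ltr_pdivlMr// lt_min => /andP[hd1 hd2].
have small (t s : R) : 0 <= t <= 1 -> 0 <= s <= 1 ->
    `|(t * h) *: u + (s * h) *: v| <= h * M.
  move=> /andP[t0 t1] /andP[s0 s1]; rewrite (le_trans (ler_normD _ _))//.
  rewrite !normrZ !ger0_norm ?mulr_ge0 ?(ltW h0)// /M !mulrDr mulr1.
  have a1 : t * h * `|u| <= h * `|u| by rewrite -mulrA ler_piMl// mulr_ge0// ltW.
  have a2 : s * h * `|v| <= h * `|v| by rewrite -mulrA ler_piMl// mulr_ge0// ltW.
  by rewrite (le_trans (lerD a1 a2))// lerDl ltW.
have h01 : 0 <= (0 : R) <= 1 by rewrite lexx ler01.
have h11 : 0 <= (1 : R) <= 1 by rewrite lexx ler01.
have der (t s : R) : 0 <= t <= 1 -> 0 <= s <= 1 ->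
    derivable f (x + (t * h) *: u + (s * h) *: v) u.
  move=> ht hs; apply: df; rewrite -ball_normE /= -addrA opprD addNKr normrN.
  by rewrite (le_lt_trans (small _ _ ht hs)).
pose F y := f (y + h *: v) - f y.
have dF (t : R) : 0 <= t <= 1 ->
    is_derive (x + (t * h) *: u) u F
     (G (x + (t * h) *: u + h *: v) - G (x + (t * h) *: u)).
  move=> ht; apply: is_deriveB; last first.
    by apply/derivableP; have := der t 0 ht h01; rewrite mul0r scale0r addr0.
  by apply: is_derive_shift_arg; have := der t 1 ht h11; rewrite mul1r.
have [t ht] := mean_value_line (fun t ht => @ex_derive _ _ _ _ _ _ _ (dF t ht)).
rewrite {1 2}/F => ->; rewrite (@derive_val _ _ _ _ _ _ _ (dF t ht)).
have bd s : 0 <= s <= 1 ->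
    `|(t * h) *: u + (s * h) *: v| < d2 by move=> /(small _ _ ht)/le_lt_trans; apply.
have := hG _ (bd 0 h01); have := hG _ (bd 1 h11).
have := small _ _ ht h01; have := small _ _ ht h11.
pose dv := 'D_v G x; pose du := 'D_u G x; rewrite -/G -/dv.
have e1 : 'd G x ((t * h) *: u) = t * h * du by rewrite linearZ /= -deriveE.
have e2 : 'd G x ((t * h) *: u + h *: v) = t * h * du + h * dv.
  by rewrite linearD e1 linearZ /= -deriveE.
rewrite mul0r mul1r scale0r addr0 e1 e2 !(addrC _ x) addrA.
set w1 := `|_ + _|; set w2 := `|_ *: u|.
set g1 := G (_ + _ + _); set g2 := G (_ + _) => hw1 hw2 b1 b2.
have -> : h * (g1 - g2) - h ^+ 2 * dv =
  h * ((g1 - G x - (t * h * du + h * dv)) - (g2 - G x - t * h * du)) by ring.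
rewrite normrM gtr0_norm// expr2 mulrCA ler_pM2l//.
rewrite (le_trans (ler_normB _ _))//.
have e : ep * h = ep / (M + M) * (h * M) + ep / (M + M) * (h * M).
  by field; rewrite gt_eqF// addr_gt0.
have mono w : w <= h * M -> ep / (M + M) * w <= ep / (M + M) * (h * M).
  by move=> hw; rewrite ler_wpM2l// ltW.
by rewrite e lerD// ?(le_trans b1 (mono _ hw1))// (le_trans b2 (mono _ hw2)).
Qed.

(** The second difference is symmetric in u and v, and divided by h^2 it approximates both mixed
    derivatives. *)
Lemma schwarz_real (f : V -> R) x u v :
  (\forall y \near x, forall w, derivable f y w) ->
  differentiable (fun y => 'D_u f y) x -> differentiable (fun y => 'D_v f y) x ->
  'D_v (fun y => 'D_u f y) x = 'D_u (fun y => 'D_v f y) x.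
Proof.
move=> df du dv; apply/eqP; rewrite -subr_eq0 -normr_le0; apply/ler_addgt0Pl => e e0.
have e20 : 0 < e / 2 by rewrite divr_gt0.
have [d1 d10 h1] := second_difference v (filterS (fun y h => h u) df) du e20.
have [d2 d20 h2] := second_difference u (filterS (fun y h => h v) df) dv e20.
pose h := Num.min d1 d2 / 2.
have m0 : 0 < Num.min d1 d2 by rewrite lt_min d10.
have h0 : 0 < h by rewrite divr_gt0.
have hm : h < Num.min d1 d2 by rewrite /h; lra.
move: hm; rewrite lt_min => /andP[hd1 hd2].
have := h1 h; have := h2 h; rewrite h0 hd1 hd2 => /(_ isT) b2 /(_ isT) b1.
move: b1 b2; rewrite (addrAC x (h *: u)).
set a := f (x + h *: v + h *: u); set b := f (x + h *: u); set c := f (x + h *: v).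
set A := 'D_v _ x; set B := 'D_u _ x => b1 b2.
have h20 : 0 < h ^+ 2 by rewrite exprn_gt0.
rewrite addr0 -(ler_pM2l h20) -[h ^+ 2 * `|_|](_ : `|h ^+ 2 * (A - B)| = _); last first.
  by rewrite normrM gtr0_norm.
have -> : h ^+ 2 * (A - B) = (a - c - (b - f x) - h ^+ 2 * B) - (a - b - (c - f x) - h ^+ 2 * A).
  by ring.
apply: le_trans (ler_normB _ _) _; apply: le_trans (lerD b2 b1) _.
by rewrite -mulrDl -splitr mulrC.
Qed.


End Schwarz.

End ClassC.

Section NearEq.
Context {R : realType}.

Lemma near_eq_differentiable (V W : normedModType R) (f g : V -> W) x :
  (\near x, f x = g x) -> differentiable f x -> differentiable g x.
Proof.
move=> fg df; have := nbhs_singleton fg => /= e0.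
apply: (differentiable_from_bound (L := 'd f x)).
- exact: linearP.
- exact: diff_continuous.
move=> ep ep0; have [d1 d10 h1] := differentiable_bound df ep0.
move: fg => /nbhs_ballP[d2 /= d20 h2].
exists (Num.min d1 d2) => [|w]; first by rewrite lt_min d10.
rewrite lt_min => /andP[w1 w2]; rewrite -e0 -(h2 (w + x)); first exact: h1.
by rewrite -ball_normE /= opprD addrCA subrr addr0 normrN.
Qed.

End NearEq.

Section VectorValued.
Context {R : realType} {V : normedModType R} {m : nat}.
Implicit Types (f g : V -> 'rV[R]_m) (x v : V).

Lemma is_derive_rV f x v (df : 'rV[R]_m) :
  (forall j, is_derive x v (fun y => f y 0 j) (df 0 j)) -> is_derive x v f df.
Proof.
move=> h.
have d : derivable f x v.
  by apply/derivable_mxP => i j; rewrite (ord1 i); exact: (@ex_derive _ _ _ _ _ _ _ (h j)).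
split=> //; rewrite derive_mx//; apply/rowP => j; rewrite !mxE.
exact: derive_val.
Qed.

Lemma is_derive_coord f x v (df : 'rV[R]_m) j :
  is_derive x v f df -> is_derive x v (fun y => f y 0 j) (df 0 j).
Proof.
move=> [d <-]; split; first by have /derivable_mxP := d; apply.
by rewrite derive_mx// !mxE.
Qed.

Lemma differentiable_rV f x :
  (forall j, differentiable (fun y => f y 0 j) x) -> differentiable f x.
Proof.
move=> h; have -> : f = \sum_j (fun y => f y 0 j *: delta_mx 0 j).
  by apply/funext => y; rewrite fct_sumE [LHS]row_sum_delta.
apply: differentiable_sum => j; exact: differentiableZl.
Qed.

Lemma differentiable_coordf f x j :
  differentiable f x -> differentiable (fun y => f y 0 j) x.
Proof.
move=> df; apply: (differentiable_comp (g := fun w : 'rV[R]_m => w 0 j)) => //.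
exact: differentiable_coord.
Qed.

Lemma is_derive_scale (k : V -> R) g x v dk dg :
  is_derive x v k dk -> is_derive x v g dg ->
  is_derive x v (fun y => k y *: g y) (k x *: dg + dk *: g x).
Proof.
move=> hk hg; apply: is_derive_rV => j.
have -> : (fun y => (k y *: g y) 0 j) = k * (fun y => g y 0 j).
  by apply/funext => y; rewrite !mxE.
rewrite !mxE (mulrC dk).
by apply: is_deriveM; exact: is_derive_coord.
Qed.

Lemma differentiable_scale (k : V -> R) g x :
  differentiable k x -> differentiable g x ->
  differentiable (fun y => k y *: g y) x.
Proof.
move=> hk hg; apply: differentiable_rV => j.
have -> : (fun y => (k y *: g y) 0 j) = k * (fun y => g y 0 j).
  by apply/funext => y; rewrite !mxE.
by apply: differentiableM => //; exact: differentiable_coordf.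
Qed.

Lemma is_derive_sumf n (h : 'I_n -> V -> 'rV[R]_m) x v (dh : 'I_n -> 'rV[R]_m) :
  (forall i, is_derive x v (h i) (dh i)) ->
  is_derive x v (fun y => \sum_i h i y) (\sum_i dh i).
Proof.
by move=> hh; have := is_derive_sum hh; rewrite fct_sumE.
Qed.

Lemma differentiable_sumf n (h : 'I_n -> V -> 'rV[R]_m) x :
  (forall i, differentiable (h i) x) ->
  differentiable (fun y => \sum_i h i y) x.
Proof. by move=> hh; have := differentiable_sum hh; rewrite fct_sumE. Qed.

Lemma schwarz f x u v :
  (\forall y \near x, forall w, derivable f y w) ->
  differentiable (fun y => 'D_u f y) x -> differentiable (fun y => 'D_v f y) x ->
  'D_v (fun y => 'D_u f y) x = 'D_u (fun y => 'D_v f y) x.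
Proof.
move=> df du dv; apply/rowP => j.
have coordD w : \near x, (fun y => 'D_w f y 0 j) x = 'D_w (fun y => f y 0 j) x.
  near=> y; rewrite derive_mx ?mxE//; near: y.
  by apply: filterS df => y; apply.
have dcoord w : differentiable (fun y => 'D_w f y) x ->
    differentiable (fun y => 'D_w (fun y => f y 0 j) y) x.
  move=> dw; apply: near_eq_differentiable (coordD w) _.
  exact: differentiable_coordf.
have E w z : differentiable (fun y => 'D_w f y) x ->
    'D_z (fun y => 'D_w f y) x 0 j = 'D_z (fun y => 'D_w f y 0 j) x.
  move=> dw; apply/esym.
  by case: (is_derive_coord (f := fun y => 'D_w f y) j
                           (derivableP (@diff_derivable _ _ _ _ _ z dw))).
apply: etrans (E u v du) _; apply: etrans _ (esym (E v u dv)).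
apply: etrans (near_eq_derive v (coordD u)) _.
apply: etrans _ (esym (near_eq_derive u (coordD v))).
apply: schwarz_real; do ?exact: dcoord.
apply: filterS df => y h w; have /derivable_mxP := h w; exact.
Unshelve. all: by end_near. Qed.

End VectorValued.

Section Chain.
Context {R : realType}.

Lemma is_derive_curve (V W : normedModType R) (f : V -> W) (c : R -> V) (t : R) (v : V) :
  is_derive t 1 c v -> differentiable f (c t) ->
  is_derive t 1 (f \o c) ('D_v f (c t)).
Proof.
move=> [dc <-] df.
have dc' : differentiable c t by apply/derivable1_diffP.
have dfc : differentiable (f \o c) t by apply: differentiable_comp.
split; first exact: diff_derivable.
by rewrite !deriveE// diff_comp.
Qed.

Lemma is_derive_chain (U V W : normedModType R) (f : V -> W) (c : U -> V) x u :
  differentiable c x -> differentiable f (c x) ->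
  is_derive x u (f \o c) ('D_('D_u c x) f (c x)).
Proof.
move=> dc df.
have dfc : differentiable (f \o c) x by apply: differentiable_comp.
split; first exact: diff_derivable.
by rewrite !deriveE// diff_comp.
Qed.

Lemma bilinear_is_derive n m k (b : 'rV[R]_n -> 'rV[R]_m -> 'rV[R]_k)
    (V : normedModType R) (f : V -> 'rV[R]_n) (g : V -> 'rV[R]_m) x v df dg :
  (forall y, linear (b y)) -> (forall z, linear (b^~ z)) ->
  is_derive x v f df -> is_derive x v g dg ->
  is_derive x v (fun y => b (f y) (g y)) (b df (g x) + b (f x) dg).
Proof.
move=> lr ll hf hg.
have bE p q : b p q = \sum_i p 0 i *: \sum_j q 0 j *: b (delta_mx 0 i) (delta_mx 0 j).
  have /(congr1 (@^~ p)) := linear_rVE (ll q); rewrite fct_sumE /= => ->.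
  apply: eq_bigr => i _; congr (_ *: _).
  by have /(congr1 (@^~ q)) := linear_rVE (lr (delta_mx 0 i)); rewrite fct_sumE.
have -> : (fun y => b (f y) (g y)) =
    (fun y => \sum_i f y 0 i *: \sum_j g y 0 j *: b (delta_mx 0 i) (delta_mx 0 j)).
  by apply/funext => y; rewrite bE.
rewrite addrC !bE -big_split /=; apply: is_derive_sumf => i.
apply: is_derive_scale; first exact: is_derive_coord.
apply: is_derive_sumf => j.
have := is_derive_scale (is_derive_coord j hg)
    (is_derive_cst (b (delta_mx 0 i) (delta_mx 0 j)) x v).
by rewrite scaler0 add0r.
Qed.

End Chain.

Section Perturbation.
Context {R : realType} {n : nat}.
Implicit Types (psi : 'rV[R]_n -> 'rV[R]_n) (x y : 'rV[R]_n).

(* A minimiser of [|y - psi x - x|] on the ball is a solution, as otherwise one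
   step of the contraction would decrease that quantity. *)
Lemma solve_perturbed_identity psi (d : R) : 0 < d -> psi 0 = 0 ->
  (forall x, `|x| <= d -> {for x, continuous psi}) ->
  (forall x y, `|x| <= d -> `|y| <= d -> `|psi y - psi x| <= 2^-1 * `|y - x|) ->
  forall y, `|y| <= d / 2 -> exists2 x, `|x| <= d & x + psi x = y.
Proof.
move=> d0 psi0 cpsi lip y yd.
pose A : set 'rV[R]_n := [set x | `|x| <= d].
pose T x := y - psi x.
have TA x : `|x| <= d -> `|T x| <= d.
  move=> xd; rewrite (le_trans (ler_normB _ _))//.
  have := lip 0 x; rewrite psi0 !subr0 normr0 => /(_ (ltW d0) xd) h.
  have : 2^-1 * `|x| <= 2^-1 * d by rewrite ler_wpM2l// invr_ge0.
  lra.
have cA : compact A.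
  apply: bounded_closed_compact.
    by exists d; split; [exact: num_real|move=> e de x /= /le_trans; apply; exact: ltW].
  have -> : A = closed_ball_ (fun x => `|x|) (0 : 'rV[R]_n) d.
    by apply/seteqP; split=> x; rewrite /A /closed_ball_ /= sub0r normrN.
  exact: closed_closed_ball_.
have A0 : A !=set0 by exists 0; rewrite /A /= normr0 ltW.
have contA : {within A, continuous (fun x => `|T x - x|)}.
  apply: continuous_in_subspaceT => x; rewrite inE => Ax.
  have c1 : {for x, continuous T}.
    by apply: continuousB; [exact: cst_continuous|exact: cpsi].
  have c2 : {for x, continuous (fun z => T z - z)}.
    by apply: continuousB; [exact: c1|exact: cvg_id].
  exact: (continuous_comp c2 (@norm_continuous _ _ _)).
have [x Ax hx] := EVT_min_rV A0 cA contA.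
move: Ax; rewrite inE => Ax; exists x => //.
have := hx (T x); rewrite inE => /(_ (TA x Ax)) le1.
have le2 : `|T (T x) - T x| <= 2^-1 * `|T x - x|.
  have -> z : T z - T x = psi x - psi z.
    by rewrite /T opprB addrC addrA subrK.
  by rewrite (distrC (T x)); apply: lip => //; exact: TA.
have : `|T x - x| <= 2^-1 * `|T x - x| by apply: le_trans le2.
have := normr_ge0 (T x - x) => p1 p2.
have /eqP : `|T x - x| = 0 by lra.
by rewrite normr_eq0 subr_eq0 /T subr_eq => /eqP ->.
Qed.

End Perturbation.

(** * The Lie algebra of a Lie group in the chart at the unit *)

Lemma derive1_line (R : realType) (V W : normedModType R) (F : V -> W) x v :
  derive1 (fun t : R => F (x + t *: v)) 0 = 'D_v F x.
Proof.
have e : (fun h : R => h^-1 *: (F (x + (h + 0) *: v) - F (x + 0 *: v))) =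
         (fun h : R => h^-1 *: ((F \o shift x) (h *: v) - F x)).
  by apply/funext => h /=; rewrite scale0r !addr0 (addrC x).
by rewrite /derive1 e.
Qed.

Lemma near_prod (T U : topologicalType) (x : T) (y : U) (P : T * U -> Prop) :
  (\forall q \near (x, y), P q) ->
  \forall x' \near x, \forall y' \near y, P (x', y').
Proof.
move=> [[A B] /= [nA nB] AB]; apply: filterS nA => x' Ax'.
by apply: filterS nB => y' By'; apply: AB.
Qed.

Section ChartAtOne.
Context {R : realType} {n : nat} (G : lieGroup R n).
Implicit Types (g h : G) (X Y Z : 'rV[R]_n).

Local Notation a := (lie_chart1 G).
Local Notation p := (chart_inv (lie_chart1 G)).
Local Notation e := (lie_chart1 G (1%g : G)).

Lemma chart_inv1 : p e = 1%g.
Proof. by rewrite chart_mapK//; exact: lie_chart1_dom. Qed.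

Lemma near_chart x : (a @` chart_dom a) x ->
  \forall y \near x, [/\ chart_dom a (p y), a (p y) = y & {for y, continuous p}].
Proof.
move=> ax; have : nbhs x (a @` chart_dom a).
  by apply: open_nbhs_nbhs; split => //; exact: chart_img_open.
apply: filterS => y [g dg <-].
by rewrite chart_mapK//; split => //; exact: chart_inv_continuous.
Qed.

Lemma chart_img1 : (a @` chart_dom a) e.
Proof. by exists 1%g => //; exact: lie_chart1_dom. Qed.

Definition near_chart1 := near_chart chart_img1.

Lemma chart_inv_cvg1 : p @ e --> (1%g : G).
Proof.
have := chart_inv_continuous (lie_chart1_dom G).
by rewrite /prop_for /continuous_at chart_inv1.
Qed.

Lemma chart_cvg1 : a @ (1%g : G) --> e.
Proof. exact: chart_continuous (lie_chart1_dom G). Qed.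

Lemma near_chart_dom1 : \forall g \near (1%g : G), chart_dom a g /\ p (a g) = g.
Proof.
have : nbhs (1%g : G) (chart_dom a).
  by apply: open_nbhs_nbhs; split; [exact: chart_dom_open|exact: lie_chart1_dom].
by apply: filterS => g dg; rewrite chart_mapK.
Qed.

Lemma near_chart_inv1 (P : G -> Prop) :
  (\forall g \near (1%g : G), P g) -> \forall x \near e, P (p x).
Proof. exact: chart_inv_cvg1. Qed.

Lemma near1_of_chart (P : G -> Prop) :
  (\forall x \near e, P (p x)) -> \forall g \near (1%g : G), P g.
Proof.
move=> /chart_cvg1 /= h; near=> g.
have [_ <-] : chart_dom a g /\ p (a g) = g by near: g; exact: near_chart_dom1.
by near: g.
Unshelve. all: by end_near. Qed.

Definition chart_mul (q : 'rV[R]_n * 'rV[R]_n) : 'rV[R]_n := a (p q.1 * p q.2)%g.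

Definition chart_invg (x : 'rV[R]_n) : 'rV[R]_n := a (p x)^-1%g.

Lemma cvg_mulg1 : (fun q : G * G => q.1 * q.2)%g @ ((1, 1)%g : G * G) --> (1%g : G).
Proof. by have := @lie_mul_continuous _ _ G (1, 1)%g; rewrite /continuous_at /= mulg1. Qed.

Lemma cvg_invg1 : (fun g : G => g^-1)%g @ (1%g : G) --> (1%g : G).
Proof. by have := (@lie_inv_smooth _ _ G).1 1%g; rewrite /continuous_at /= invg1. Qed.

Lemma near_mul1 (P : G -> Prop) : (\forall g \near (1%g : G), P g) ->
  \forall q \near (e, e), P (p q.1 * p q.2)%g.
Proof.
move=> /cvg_mulg1 [[A B] /= [nA nB] AB].
exists (p @^-1` A, p @^-1` B) => [|q [/= h1 h2]].
  by split; exact: chart_inv_cvg1.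
exact: (AB (p q.1, p q.2)).
Qed.

Lemma near_chart_mul : \forall q \near (e, e),
  [/\ chart_dom a (p q.1), chart_dom a (p q.2), a (p q.1) = q.1, a (p q.2) = q.2 &
     chart_dom a (p q.1 * p q.2)%g /\ p (chart_mul q) = (p q.1 * p q.2)%g].
Proof.
have h1 := near_mul1 near_chart_dom1.
have h2 : \forall q \near (e, e), [/\ chart_dom a (p q.1), a (p q.1) = q.1,
   chart_dom a (p q.2) & a (p q.2) = q.2].
  exists ([set x | chart_dom a (p x) /\ a (p x) = x],
          [set x | chart_dom a (p x) /\ a (p x) = x]).
    by split; apply: filterS near_chart1 => x [].
  by move=> q [/= [? ?] [? ?]].
by apply: filterS2 h1 h2 => q [d1 e1] [d2 e2 d3 e3].
Qed.

(** Smoothness is read at orders 1 and 2; order 2 makes the directional derivatives differentiable,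
    as the bracket is a mixed second derivative. *)
Lemma chart_mul_smooth : \forall q \near (e, e),
  differentiable chart_mul q /\ forall v, differentiable (fun q => 'D_v chart_mul q) q.
Proof.
pose U := [set x | exists g h, [/\ chart_dom a g, chart_dom a h,
                               chart_dom a (g * h)%g & x = (a g, a h)]].
have UN : nbhs (e, e) U.
  apply: filterS near_chart_mul => q [d1 d2 e1 e2 [d3 _]].
  by exists (p q.1), (p q.2); split; rewrite // e1 e2; case: (q).
have at1 := lie_chart1_atlas G.
have S := lie_mul_smooth at1 at1 at1.
apply: filterS (nbhs_interior UN) => q Uq; split.
  exact: (class_C1_pair_differentiable (S 1%N) Uq).
by move=> v; have [_ S2] := S 2%N; exact: (class_C1_pair_differentiable (S2 v) Uq).
Qed.

Lemma near_chart_invg : \forall x \near e,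
  [/\ chart_dom a (p x), a (p x) = x, chart_dom a (p x)^-1%g &
      p (chart_invg x) = (p x)^-1%g].
Proof.
have h1 : \forall x \near e, chart_dom a (p x)^-1%g /\ p (a (p x)^-1%g) = (p x)^-1%g.
  apply: (@near_chart_inv1 (fun g => chart_dom a g^-1%g /\ p (a g^-1%g) = g^-1%g)).
  exact: cvg_invg1 near_chart_dom1.
by apply: filterS2 h1 near_chart1 => x [d1 e1] [d2 e2 _].
Qed.

Lemma smooth_map_chart1 (f : G -> G) : smooth_map (lie_atlas G) f -> f 1%g = 1%g ->
  class_C 1 (fun x => a (f (p x))) (a @` [set g | chart_dom a g /\ chart_dom a (f g)])
  /\ nbhs e (a @` [set g | chart_dom a g /\ chart_dom a (f g)]).
Proof.
move=> [cf sf] f1; have at1 := lie_chart1_atlas G; split; first exact: sf.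
have h : \forall x \near e, chart_dom a (f (p x)).
  apply: (@near_chart_inv1 (fun g => chart_dom a (f g))).
  apply: cf; rewrite f1.
  by apply: filterS near_chart_dom1 => g [].
by apply: filterS2 h near_chart1 => x d1 [d2 e2 _]; exists (p x).
Qed.

Lemma chart_invg_differentiable : differentiable chart_invg e.
Proof.
have [c N] := smooth_map_chart1 (@lie_inv_smooth _ _ G) (invg1 _).
exact: class_C1_differentiable c N.
Qed.

Lemma chart_invg1 : chart_invg e = e.
Proof. by rewrite /chart_invg chart_inv1 invg1. Qed.

End ChartAtOne.

Lemma derive_pair (R : realType) (U V W : normedModType R) (f : U -> V) (g : U -> W)
    x v : differentiable f x -> differentiable g x ->
  'D_v (fun y => (f y, g y)) x = ('D_v f x, 'D_v g x).
Proof.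
move=> df dg; rewrite deriveE; last exact: differentiable_pair.
by rewrite diff_pair// !deriveE.
Qed.

Lemma derive_addv (R : realType) (U V : normedModType R) (f : U -> V) x v w :
  differentiable f x -> 'D_(v + w) f x = 'D_v f x + 'D_w f x.
Proof. by move=> df; rewrite !deriveE// linearD. Qed.

Lemma derive_oppv (R : realType) (U V : normedModType R) (f : U -> V) x v :
  differentiable f x -> 'D_(- v) f x = - 'D_v f x.
Proof. by move=> df; rewrite !deriveE// linearN. Qed.

Lemma derive_linearv (R : realType) (U V : normedModType R) (f : U -> V) x :
  differentiable f x -> linear (fun v => 'D_v f x).
Proof. by move=> df k u v; rewrite !deriveE// linearP. Qed.

(** Replaces a direction that may vary with the base point by the fixed coordinate directions, so
    that the derivative can be differentiated again. *)
Lemma derive_fst_rV (R : realType) n (V W : normedModType R) (f : 'rV[R]_n * V -> W) q v :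
  differentiable f q ->
  'D_(v, 0) f q = \sum_j v 0 j *: 'D_(delta_mx 0 j, 0) f q.
Proof.
move=> df; have l : linear (fun v : 'rV[R]_n => 'D_(v, 0) f q).
  move=> k u w; rewrite -(derive_linearv df).
  by congr ('D_ _ f q); congr pair; rewrite /= scaler0 addr0.
by have /(congr1 (@^~ v)) := linear_rVE l; rewrite fct_sumE.
Qed.

(** * Ad and the bracket through the group law in the chart *)

Section Bracket.
Context {R : realType} {n : nat} (G : lieGroup R n).
Implicit Types (g h : G) (X Y Z : 'rV[R]_n).

Local Notation a := (lie_chart1 G).
Local Notation p := (chart_inv (lie_chart1 G)).
Local Notation e := (lie_chart1 G (1%g : G)).
Local Notation M := (@chart_mul R n G).
Local Notation I := (@chart_invg R n G).

Definition in_chart (f : G -> G) (x : 'rV[R]_n) : 'rV[R]_n := a (f (p x)).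

Lemma diff1_in_chart (f : G -> G) X : diff1 f X = 'D_X (in_chart f) e.
Proof. exact: (derive1_line (in_chart f)). Qed.

Lemma bracketE X Y : bracket G X Y = 'D_X (fun x => Ad (p x) Y) e.
Proof. exact: (derive1_line (fun x => Ad (p x) Y)). Qed.

Definition conj_by g h : G := (g * h * g^-1)%g.

Lemma near_chart_mule : \forall x \near e, M (x, e) = x /\ M (e, x) = x.
Proof.
by apply: filterS (@near_chart1 _ _ G) => x [_ h _]; rewrite /chart_mul /= chart_inv1 mulg1 mul1g.
Qed.

Lemma differentiable_pairl (V W : normedModType R) (y : W) (x : V) :
  differentiable (fun z : V => (z, y)) x.
Proof. by apply: differentiable_pair. Qed.

Lemma differentiable_pairr (V W : normedModType R) (x : V) (y : W) :
  differentiable (fun z : W => (x, z)) y.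
Proof. by apply: differentiable_pair. Qed.

Lemma derive_pairl (V W : normedModType R) (y : W) (x v : V) :
  'D_v (fun z : V => (z, y)) x = (v, 0).
Proof.
apply: etrans (derive_pair v _ _) _; [exact: ex_diff|exact: differentiable_cst|].
by congr pair; [exact: derive_id|exact: derive_cst].
Qed.

Lemma derive_pairr (V W : normedModType R) (x : V) (y v : W) :
  'D_v (fun z : W => (x, z)) y = (0, v).
Proof.
apply: etrans (derive_pair v _ _) _; [exact: differentiable_cst|exact: ex_diff|].
by congr pair; [exact: derive_cst|exact: derive_id].
Qed.

Lemma pair_invg_differentiable : differentiable (fun x => (x, I x)) e.
Proof. by apply: differentiable_pair => //; exact: chart_invg_differentiable. Qed.

Lemma near_pair_invg (P : 'rV[R]_n * 'rV[R]_n -> Prop) :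
  (\forall q \near (e, e), P q) -> \forall x \near e, P (x, I x).
Proof.
have := differentiable_continuous pair_invg_differentiable.
by rewrite /prop_for /continuous_at chart_invg1; apply.
Qed.

Lemma is_derive_pairl (W : normedModType R) (f : 'rV[R]_n * 'rV[R]_n -> W) x y v :
  differentiable f (x, y) ->
  is_derive x v (fun z => f (z, y)) ('D_(v, 0) f (x, y)).
Proof.
move=> df; have := @is_derive_chain _ _ _ _ f (fun z => (z, y)) x v (differentiable_pairl _ _) df.
by rewrite derive_pairl.
Qed.

Lemma is_derive_pairr (W : normedModType R) (f : 'rV[R]_n * 'rV[R]_n -> W) x y v :
  differentiable f (x, y) ->
  is_derive y v (fun z => f (x, z)) ('D_(0, v) f (x, y)).
Proof.
move=> df; have := @is_derive_chain _ _ _ _ f (fun z => (x, z)) y v (differentiable_pairr _ _) df.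
by rewrite derive_pairr.
Qed.

(** Conjugation by x reads y |-> M(M(x, y), I x) near [e], and the chain rule is applied at y = [e],
    where M(x, y) = x. *)
Lemma near_Ad : \forall x \near e, differentiable (in_chart (conj_by (p x))) e /\
  forall Y, Ad (p x) Y = 'D_('D_(0, Y) M (x, e), 0) M (x, I x).
Proof.
have dMn : \forall q \near (e, e), differentiable M q.
  by apply: filterS (@chart_mul_smooth _ _ G) => q [].
near=> x.
have dM1 : differentiable M (x, e).
  near: x; apply: filterS (near_prod dMn) => x; exact: nbhs_singleton.
have dM2 : differentiable M (x, I x).
  near: x; exact: near_pair_invg dMn.
have Mxe : M (x, e) = x.
  by near: x; apply: filterS near_chart_mule => x [].
have pI : p (I x) = (p x)^-1%g.
  by near: x; apply: filterS (@near_chart_invg _ _ G) => x [].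
have eqF : \forall y \near e, M (M (x, y), I x) = in_chart (conj_by (p x)) y.
  have : \forall y \near e, p (M (x, y)) = (p x * p y)%g.
    near: x; have := near_prod (@near_chart_mul _ _ G).
    by apply: filterS => x; apply: filterS => y [_ _ _ _ [_ ->]].
  by apply: filterS => y py; rewrite {1}/chart_mul /= py pI.
have dc : differentiable (fun y => M (x, y)) e.
  by apply: differentiable_comp (differentiable_pairr _ _) dM1.
have dF : differentiable (fun z => M (z, I x)) (M (x, e)).
  by rewrite Mxe; apply: differentiable_comp (differentiable_pairl _ _) dM2.
have dFc := differentiable_comp dc dF.
split; first exact: near_eq_differentiable dFc.
move=> Y; rewrite [LHS]diff1_in_chart -(near_eq_derive Y eqF).
have [_ ->] := @is_derive_chain _ _ _ _ _ _ e Y dc dF.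
have [_ ->] := is_derive_pairr Y dM1.
by rewrite Mxe; have [_ ->] := is_derive_pairl ('D_(0, Y) M (x, e)) dM2.
Unshelve. all: by end_near. Qed.

End Bracket.

Section BracketFormula.
Context {R : realType} {n : nat} (G : lieGroup R n).
Implicit Types (g h : G) (X Y Z : 'rV[R]_n).

Local Notation a := (lie_chart1 G).
Local Notation p := (chart_inv (lie_chart1 G)).
Local Notation e := (lie_chart1 G (1%g : G)).
Local Notation M := (@chart_mul R n G).
Local Notation I := (@chart_invg R n G).
Local Notation e_ j := (delta_mx (0 : 'I_1) j : 'rV[R]_n).

Lemma chart_mul_diff : \forall q \near (e, e), differentiable M q.
Proof. by apply: filterS (@chart_mul_smooth _ _ G) => q []. Qed.

Lemma chart_mul_diff1 : differentiable M (e, e).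
Proof. exact: nbhs_singleton chart_mul_diff. Qed.

Lemma chart_mul_diff2 v : differentiable (fun q => 'D_v M q) (e, e).
Proof. by have [_] := nbhs_singleton (@chart_mul_smooth _ _ G). Qed.

Lemma derive_chart_mul_l : \forall x \near e, forall X, 'D_(X, 0) M (x, e) = X.
Proof.
have h1 : \forall x \near e, differentiable M (x, e).
  by apply: filterS (near_prod chart_mul_diff) => x; exact: nbhs_singleton.
have h2 : \forall x \near e, \forall y \near x, M (y, e) = y.
  by apply: nbhs_interior; apply: filterS (@near_chart_mule _ _ G) => x [].
apply: filterS2 h1 h2 => x d m X.
have [_ <-] := is_derive_pairl X d.
by rewrite (near_eq_derive X m); exact: derive_id.
Qed.

Lemma derive_chart_mul_r Y : 'D_(0, Y) M (e, e) = Y.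
Proof.
have [_ <-] := is_derive_pairr Y chart_mul_diff1.
have m : \forall y \near e, M (e, y) = y.
  by apply: filterS (@near_chart_mule _ _ G) => x [].
by rewrite (near_eq_derive Y m); exact: derive_id.
Qed.

Lemma derive_chart_mul X Y : 'D_(X, Y) M (e, e) = X + Y.
Proof.
have -> : (X, Y) = (X, 0) + (0, Y) by congr pair; rewrite /= ?addr0 ?add0r.
rewrite (derive_addv _ _ chart_mul_diff1) derive_chart_mul_r.
by have := nbhs_singleton derive_chart_mul_l => ->.
Qed.

(** Differentiate the constant M(x, I x) = e. *)
Lemma derive_chart_invg X : 'D_X I e = - X.
Proof.
have dI := @chart_invg_differentiable _ _ G.
have dP := @pair_invg_differentiable _ _ G.
have dM : differentiable M (e, I e) by rewrite chart_invg1; exact: chart_mul_diff1.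
have [_ h] := is_derive_chain X dP dM.
have : \forall x \near e, (M \o (fun x => (x, I x))) x = e.
  apply: filterS (@near_chart_invg _ _ G) => x [_ _ _ px].
  by rewrite /= /chart_mul /= px mulgV.
move=> /(near_eq_derive X); rewrite h (derive_cst e) chart_invg1.
rewrite (derive_pair X (@ex_diff _ _ _ _ _ _ _ (is_diff_id e)) dI) derive_id.
by rewrite derive_chart_mul => /eqP; rewrite addrC addr_eq0 => /eqP.
Qed.

(** In coordinates centred at [e] the group law is x + y + b(x, y) + higher order terms, as M(x, e)
    = x and M(e, y) = y. *)
Definition mixed_derivative X Y := 'D_(X, 0) (fun q => 'D_(0, Y) M q) (e, e).
Local Notation b := mixed_derivative.

(** Along the points (z, e) the derivative of M in direction (X, 0) is constantly X, so only the
    part in direction (0, X) contributes. *)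
Lemma derive_mixed_swap X Y :
  'D_(Y, 0) (fun q => 'D_(X, - X) M q) (e, e) = - b Y X.
Proof.
have h : \forall q \near (e, e), 'D_(X, - X) M q = 'D_(X, 0) M q - 'D_(0, X) M q.
  apply: filterS chart_mul_diff => q dq.
  have -> : (X, - X) = (X, 0) + - (0, X).
    by congr pair; rewrite /= ?oppr0 ?addr0 ?add0r.
  by rewrite (derive_addv _ _ dq) (derive_oppv _ dq).
rewrite (near_eq_derive _ h).
have dv v := diff_derivable (v := (Y, 0) : 'rV[R]_n * 'rV[R]_n) (chart_mul_diff2 v).
have -> : (fun q => 'D_(X, 0) M q - 'D_(0, X) M q) =
    (fun q => 'D_(X, 0) M q) - (fun q => 'D_(0, X) M q) by [].
rewrite deriveB//.
have hc : \forall x \near e, (fun z => 'D_(X, 0) M (z, e)) x = cst X x.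
  by apply: filterS derive_chart_mul_l => x /(_ X).
have z0 : 'D_(Y, 0) (fun q => 'D_(X, 0) M q) (e, e) = 0.
  have [_ h0] := is_derive_pairl Y (chart_mul_diff2 (X, 0)).
  apply: etrans (esym h0) _.
  by apply: etrans (near_eq_derive _ hc) _; exact: (derive_cst X).
by rewrite z0 sub0r.
Qed.

Let W Y x := 'D_(0, Y) M (x, e).
Let A j x := 'D_(e_ j, 0) M (x, I x).

Let near_AdE Y : \forall x \near e, \sum_j W Y x 0 j *: A j x = Ad (p x) Y.
Proof.
apply: filterS2 (@near_Ad _ _ G) (near_pair_invg chart_mul_diff) => x [_ ->] dM.
by rewrite (derive_fst_rV _ dM).
Qed.

Let W_diff Y : differentiable (W Y) e.
Proof.
by apply: (differentiable_comp (f := fun x => (x, e)) (g := fun q => 'D_(0, Y) M q));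
  [exact: differentiable_pairl|exact: chart_mul_diff2].
Qed.

Let A_diff j : differentiable (A j) e.
Proof.
apply: (differentiable_comp (f := fun x => (x, I x)) (g := fun q => 'D_(e_ j, 0) M q)).
  exact: pair_invg_differentiable.
by rewrite chart_invg1; exact: chart_mul_diff2.
Qed.

Lemma Ad_differentiable Y : differentiable (fun x => Ad (p x) Y) e.
Proof.
apply: near_eq_differentiable (near_AdE Y) _.
apply: differentiable_sumf => j; apply: differentiable_scale; last exact: A_diff.
exact: differentiable_coordf (W_diff Y).
Qed.

(** Product rule for Ad(x) Y = sum_j W_j(x) A_j(x). At [e] the vectors A_j are the unit vectors, so
    differentiating W gives b(X, Y); differentiating A gives - b(Y, X). *)
Lemma bracket_mixed X Y : bracket G X Y = b X Y - b Y X.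
Proof.
rewrite bracketE -(near_eq_derive X (near_AdE Y)).
have dW : is_derive e X (W Y) (b X Y).
  exact: is_derive_pairl (chart_mul_diff2 (0, Y)).
have dA j : is_derive e X (A j) ('D_(X, - X) (fun q => 'D_(e_ j, 0) M q) (e, e)).
  have dI := @chart_invg_differentiable _ _ G.
  have := @is_derive_chain _ _ _ _ (fun q => 'D_(e_ j, 0) M q) (fun x => (x, I x)) e X
    (@pair_invg_differentiable _ _ G).
  rewrite chart_invg1 => /(_ (chart_mul_diff2 _)).
  rewrite (derive_pair X (@ex_diff _ _ _ _ _ _ _ (is_diff_id e)) dI) derive_id.
  by rewrite derive_chart_invg.
have [_ ->] := is_derive_sumf (fun j => is_derive_scale (is_derive_coord j dW) (dA j)).
rewrite big_split /= addrC; congr (_ + _).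
  rewrite [RHS]row_sum_delta; apply: eq_bigr => j _; congr (_ *: _).
  by rewrite /A chart_invg1; have := nbhs_singleton derive_chart_mul_l => ->.
(* Exchanging the derivatives makes the inner direction independent of j, so that the sum over j
   recombines into the direction (Y, 0). *)
have sw j : 'D_(X, - X) (fun q => 'D_(e_ j, 0) M q) (e, e) =
            'D_(e_ j, 0) (fun q => 'D_(X, - X) M q) (e, e).
  apply: schwarz; do ?exact: chart_mul_diff2.
  by apply: filterS chart_mul_diff => q dq w; exact: diff_derivable.
under eq_bigr do rewrite sw /W derive_chart_mul_r.
by rewrite -(derive_fst_rV _ (chart_mul_diff2 _)) derive_mixed_swap.
Qed.

Lemma bracket_anti X Y : bracket G X Y = - bracket G Y X.
Proof. by rewrite !bracket_mixed opprB. Qed.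

Lemma bracket_linearl Y : linear (fun X => bracket G X Y).
Proof.
move=> k X Z; rewrite !bracketE.
exact: (derive_linearv (Ad_differentiable Y)).
Qed.

Lemma bracket_linearr X : linear (bracket G X).
Proof.
move=> k Y Z; rewrite (bracket_anti X (k *: Y + Z)) (bracket_anti X Y) (bracket_anti X Z).
have /= -> := bracket_linearl X k Y Z.
by rewrite opprD scalerN.
Qed.

End BracketFormula.

Lemma is_derive_unique (R : realType) (V W : normedModType R) (f : V -> W) x v d1 d2 :
  is_derive x v f d1 -> is_derive x v f d2 -> d1 = d2.
Proof. by move=> [_ <-] [_ <-]. Qed.

(** * Curves through 1, Ad as an automorphism, the Jacobi identity *)

Section Curves.
Context {R : realType} {n : nat} (G : lieGroup R n).
Implicit Types (g h : G) (X Y Z : 'rV[R]_n).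

Local Notation a := (lie_chart1 G).
Local Notation p := (chart_inv (lie_chart1 G)).
Local Notation e := (lie_chart1 G (1%g : G)).

Definition has_velocity (c : R -> G) X : Prop :=
  [/\ c 0 = 1%g, {for 0, continuous c} & is_derive (0 : R) 1 (a \o c) X].

Lemma velocity_near c X (P : G -> Prop) : has_velocity c X ->
  (\forall g \near (1%g : G), P g) -> \forall t \near (0 : R), P (c t).
Proof. by move=> [c0 cc _] NP; apply: cc; rewrite c0. Qed.

Lemma lie_point_velocity X : has_velocity (fun t : R => lie_point G (t *: X)) X.
Proof.
pose l (t : R) := e + t *: X.
have dl : is_derive (0 : R) 1 l X.
  have lX : linear (fun t : R^o => t *: X).
    by move=> k u v; rewrite scalerDl scalerA.
  have d2 : is_derive (0 : R) 1 (fun t : R => t *: X) X.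
    by have := derive_linear (0 : R^o) (1 : R^o) lX; rewrite scale1r.
  have := is_deriveD (is_derive_cst e (0 : R) 1) d2.
  by rewrite add0r.
have l0 : l 0 = e by rewrite /l scale0r addr0.
have cl : {for 0, continuous l}.
  by apply: differentiable_continuous; apply/derivable1_diffP; exact: ex_derive.
have cc : {for 0, continuous (fun t : R => lie_point G (t *: X))}.
  apply: (continuous_comp (f := l) (g := p)) => //.
  by rewrite l0; exact: chart_inv_continuous (lie_chart1_dom G).
split=> //; first by rewrite scale0r /lie_point addr0 chart_inv1.
apply: near_eq_is_derive dl.
have : nbhs (l 0) [set x | a (p x) = x].
  by rewrite l0; apply: filterS (@near_chart1 _ _ G) => x [].
move=> /cl h; near=> t; apply/esym; near: t; exact: h.
Unshelve. all: by end_near. Qed.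

Lemma velocity_unique c X Y : has_velocity c X -> has_velocity c Y -> X = Y.
Proof. by move=> [_ _ +] [_ _]; exact: is_derive_unique. Qed.

Lemma velocity_map c X (f : G -> G) : has_velocity c X -> f 1%g = 1%g ->
  {for 1%g, continuous f} -> differentiable (in_chart f) e ->
  has_velocity (f \o c) (diff1 f X).
Proof.
move=> hc f1 cf df; have [c0 cc dc] := hc; split.
- by rewrite /= c0.
- by apply: continuous_comp => //; rewrite c0.
rewrite diff1_in_chart -c0.
have := is_derive_curve (f := in_chart f) dc; rewrite /= c0 => /(_ df).
apply: near_eq_is_derive.
by have := velocity_near hc (@near_chart_dom1 _ _ G); apply: filterS => t [_ h];
  rewrite /= /in_chart h.
Qed.

(** The bracket is defined along [lie_point]; by the chain rule any curve with velocity X serves, in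
    particular curves in H and images under conjugation or the involution. *)
Lemma Ad_curve c X Y : has_velocity c X ->
  is_derive (0 : R) 1 (fun t : R => Ad (c t) Y) (bracket G X Y).
Proof.
move=> hc; have [c0 _ dc] := hc.
have := is_derive_curve (f := fun x => Ad (p x) Y) dc.
rewrite /= c0 -bracketE => /(_ (@Ad_differentiable _ _ G Y)).
apply: near_eq_is_derive.
by have := velocity_near hc (@near_chart_dom1 _ _ G); apply: filterS => t [_ h] /=;
  rewrite h.
Qed.

Lemma conj_by_continuous g : continuous (conj_by g).
Proof.
have cmul (k : G) (F : G -> G) : continuous F -> continuous (fun h => k * F h)%g /\
    continuous (fun h => F h * k)%g.
  move=> cF; split=> h.
    apply: (@continuous_comp _ _ _ (fun h => (k, F h)) (fun q => q.1 * q.2)%g).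
      by apply: (@cvg_pair _ _ _ (nbhs h) (nbhs k) (nbhs (F h))); [exact: cvg_cst|exact: cF].
    exact: lie_mul_continuous.
  apply: (@continuous_comp _ _ _ (fun h => (F h, k)) (fun q => q.1 * q.2)%g).
    by apply: (@cvg_pair _ _ _ (nbhs h) (nbhs (F h)) (nbhs k)); [exact: cF|exact: cvg_cst].
  exact: lie_mul_continuous.
have [c1 _] := cmul g id (fun x => @cvg_id _ _).
by have [_ c2] := cmul g^-1%g _ c1.
Qed.

Lemma conj_by1 g : conj_by g 1%g = 1%g.
Proof. by rewrite /conj_by mulg1 mulgV. Qed.

(* Elements whose conjugation is differentiable in the chart at [1]; in fact all
   of [G], but a neighbourhood of [1] suffices. *)
Definition Ad_regular g : Prop := differentiable (in_chart (conj_by g)) e.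

Lemma near_Ad_regular : \forall g \near (1%g : G), Ad_regular g.
Proof. by apply: near1_of_chart; apply: filterS (@near_Ad _ _ G) => x []. Qed.

Lemma near_invg (P : G -> Prop) : (\forall g \near (1%g : G), P g) ->
  \forall g \near (1%g : G), P g^-1%g.
Proof. exact: cvg_invg1. Qed.

Lemma Ad_regular_linear g : Ad_regular g -> linear (Ad g).
Proof.
move=> hg k Y Z; rewrite [Ad g _]diff1_in_chart [Ad g Y]diff1_in_chart [Ad g Z]diff1_in_chart.
exact: derive_linearv.
Qed.

Lemma Ad_velocity c g X : Ad_regular g -> has_velocity c X ->
  has_velocity (conj_by g \o c) (Ad g X).
Proof.
move=> hg hc; apply: velocity_map => //; first exact: conj_by1.
exact: conj_by_continuous.
Qed.

Lemma diff1_velocity (f : G -> G) Y Z :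
  has_velocity (fun t : R => f (lie_point G (t *: Y))) Z -> diff1 f Y = Z.
Proof. by move=> [_ _ [_ h]]; apply: etrans h; exact: derive1E. Qed.

Lemma AdM g h Y : Ad_regular g -> Ad_regular h -> Ad (g * h)%g Y = Ad g (Ad h Y).
Proof.
move=> hg hh; apply: diff1_velocity.
have := Ad_velocity hg (Ad_velocity hh (lie_point_velocity Y)).
congr has_velocity; apply/funext => t /=.
by rewrite /conj_by invgM !mulgA.
Qed.

Lemma Ad1 Y : Ad (1%g : G) Y = Y.
Proof.
apply: diff1_velocity; have := lie_point_velocity Y.
by congr has_velocity; apply/funext => t /=; rewrite mul1g invg1 mulg1.
Qed.

Lemma Ad_linear_differentiable g X : Ad_regular g -> differentiable (Ad g) X.
Proof. by move=> /Ad_regular_linear; exact: linear_rV_differentiable. Qed.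

(** Differentiate Ad(g) Ad(c t) Z = Ad(g c(t) g^-1) Ad(g) Z at t = 0, for a curve c with velocity
    Y. *)
Lemma Ad_bracket g Y Z : Ad_regular g ->
  Ad g (bracket G Y Z) = bracket G (Ad g Y) (Ad g Z).
Proof.
move=> hg; have hY := lie_point_velocity Y.
have := Ad_curve (Ad g Z) (Ad_velocity hg hY).
have := is_derive_curve (Ad_curve Z hY) (Ad_linear_differentiable _ hg).
have [_ ->] := derive_linear (Ad (lie_point G (0 *: Y)) Z) (bracket G Y Z) (Ad_regular_linear hg).
move=> d1 d2; apply: is_derive_unique d1 _; apply: near_eq_is_derive d2.
have reg : \forall h \near (1%g : G), Ad_regular h /\ Ad_regular (conj_by g h).
  apply: filterS2 near_Ad_regular _ => [h h1 h2|]; first exact: (conj h1 h2).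
  have := @conj_by_continuous g 1%g; rewrite /continuous_at conj_by1.
  by apply; exact: near_Ad_regular.
have := velocity_near hY reg; apply: filterS => t [r1 r2] /=.
by rewrite -AdM// -AdM// /conj_by mulgVK.
Qed.

(** Differentiate Ad(c t) [Y, Z] = [Ad(c t) Y, Ad(c t) Z] at t = 0, for a curve c with velocity
    X. *)
Lemma jacobi X Y Z : bracket G X (bracket G Y Z) =
  bracket G (bracket G X Y) Z + bracket G Y (bracket G X Z).
Proof.
have hX := lie_point_velocity X.
have := bilinear_is_derive (@bracket_linearr _ _ G) (@bracket_linearl _ _ G)
  (Ad_curve Y hX) (Ad_curve Z hX).
rewrite !scale0r; have -> : lie_point G (0 : 'rV[R]_n) = 1%g :> G.
  by rewrite /lie_point addr0 chart_inv1.
rewrite !Ad1 => d2; apply: is_derive_unique d2.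
apply: near_eq_is_derive (Ad_curve (bracket G Y Z) hX).
have := velocity_near hX near_Ad_regular; apply: filterS => t h.
exact: Ad_bracket.
Qed.

Section Involution.
Variable sigma : G -> G.
Hypothesis sigma_inv : lie_involution sigma.

Lemma sigma1 : sigma 1%g = 1%g.
Proof.
have [_ sM _] := sigma_inv; have := sM 1%g 1%g; rewrite mulg1 => h.
by apply: (mulgI (sigma 1%g)); rewrite -h mulg1.
Qed.

Lemma sigmaV g : sigma g^-1%g = (sigma g)^-1%g.
Proof.
have [_ sM _] := sigma_inv; apply: (mulgI (sigma g)).
by rewrite -sM !mulgV sigma1.
Qed.

Lemma sigma_differentiable : differentiable (in_chart sigma) e.
Proof.
have [ss _ _] := sigma_inv; have [c N] := smooth_map_chart1 ss sigma1.
exact: class_C1_differentiable c N.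
Qed.

Lemma sigma_continuous : continuous sigma.
Proof. by have [[]] := sigma_inv. Qed.

Lemma sigma_velocity c X : has_velocity c X ->
  has_velocity (sigma \o c) (diff1 sigma X).
Proof.
move=> hc; apply: velocity_map => //; first exact: sigma1.
  exact: sigma_continuous.
exact: sigma_differentiable.
Qed.

Lemma diff1_sigma_linear : linear (diff1 sigma).
Proof.
move=> k X Y; rewrite !diff1_in_chart; exact: (derive_linearv sigma_differentiable).
Qed.

Lemma diff1_sigmaK : involutive (diff1 sigma).
Proof.
move=> X; have := sigma_velocity (sigma_velocity (lie_point_velocity X)).
have -> : sigma \o (sigma \o (fun t : R => lie_point G (t *: X))) =
    (fun t : R => lie_point G (t *: X)).
  by apply/funext => t /=; have [_ _ ->] := sigma_inv.
by move=> /velocity_unique; apply; exact: lie_point_velocity.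
Qed.

Lemma diff1_sigma_Ad g Y : Ad_regular g -> Ad_regular (sigma g) ->
  diff1 sigma (Ad g Y) = Ad (sigma g) (diff1 sigma Y).
Proof.
move=> hg hs; have hY := lie_point_velocity Y.
have h1 := sigma_velocity (Ad_velocity hg hY).
have := Ad_velocity hs (sigma_velocity hY).
have -> : conj_by (sigma g) \o (sigma \o (fun t : R => lie_point G (t *: Y))) =
   sigma \o (conj_by g \o (fun t : R => lie_point G (t *: Y))).
  by apply/funext => t /=; have [_ sM _] := sigma_inv; rewrite /conj_by !sM sigmaV.
by move/velocity_unique => /(_ _ h1).
Qed.

Lemma diff1_sigma_bracket X Y :
  diff1 sigma (bracket G X Y) = bracket G (diff1 sigma X) (diff1 sigma Y).
Proof.
have hX := lie_point_velocity X.
have d2 := Ad_curve (diff1 sigma Y) (sigma_velocity hX).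
have := is_derive_curve (Ad_curve Y hX) (linear_rV_differentiable _ diff1_sigma_linear).
have [_ ->] := derive_linear (Ad (lie_point G (0 *: X)) Y) (bracket G X Y) diff1_sigma_linear.
move=> d1; apply: is_derive_unique d1 _; apply: near_eq_is_derive d2.
have reg : \forall g \near (1%g : G), Ad_regular g /\ Ad_regular (sigma g).
  apply: filterS2 near_Ad_regular _ => [h h1 h2|]; first exact: (conj h1 h2).
  have := @sigma_continuous 1%g; rewrite /continuous_at sigma1.
  by apply; exact: near_Ad_regular.
have := velocity_near hX reg; apply: filterS => t [r1 r2] /=.
by rewrite diff1_sigma_Ad.
Qed.

End Involution.

End Curves.

Lemma is_derive_from_bound (R : realType) (V : normedModType R) (f : R -> V) (d : V) :
  (forall ep : R, 0 < ep -> exists2 r : R, 0 < r & forall h : R, `|h| < r ->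
     `|f h - f 0 - h *: d| <= ep * `|h|) ->
  is_derive (0 : R) 1 f d.
Proof.
move=> hf.
have e : (fun h : R => h^-1 *: ((f \o shift 0) (h *: 1) - f 0)) @ 0^' --> d.
  apply/cvgrPdist_le => ep ep0; have [r r0 hr] := hf ep ep0.
  rewrite near_withinE; apply/nbhs_ballP; exists r => // h.
  rewrite -ball_normE /= sub0r normrN => hlt h0.
  rewrite addr0 [h%:A]mulr1 distrC.
  have -> : h^-1 *: (f h - f 0) - d = h^-1 *: (f h - f 0 - h *: d).
    by rewrite [in RHS]scalerBr scalerA mulVf// scale1r.
  by rewrite normrZ normfV ler_pdivrMl ?normr_gt0// mulrC; exact: hr.
by split; [apply/cvg_ex; exists d|apply/cvg_lim].
Qed.

Lemma continuous_from_bound (R : realType) (V W : normedModType R) (f : V -> W) x :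
  (forall ep : R, 0 < ep -> exists2 r : R, 0 < r & forall y, `|x - y| < r ->
     `|f x - f y| <= ep) -> {for x, continuous f}.
Proof.
move=> hf; apply/cvgrPdist_le => ep ep0; have [r r0 hr] := hf ep ep0.
by apply/nbhs_ballP; exists r => // y; rewrite -ball_normE /= => /hr.
Qed.

Lemma clamp_lipschitz (R : realType) (r t u : R) : 0 <= r ->
  `|Num.max (- r) (Num.min r t) - Num.max (- r) (Num.min r u)| <= `|t - u|.
Proof.
move=> r0; rewrite ler_norml.
have hr : - r <= r by lra.
case: (ger0P (t - u)) => h3;
case: (lerP r t) => h1; case: (lerP r u) => h2; rewrite ?(max_r hr);
case: (lerP (- r) t) => h4; case: (lerP (- r) u) => h5; apply/andP; split; lra.
Qed.

(** * Curves in the identity component of the fixed group *)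

Section FixedCurve.
Context {R : realType} {n : nat} (G : lieGroup R n).
Implicit Types (g h : G) (X Y Z : 'rV[R]_n).

Local Notation a := (lie_chart1 G).
Local Notation p := (chart_inv (lie_chart1 G)).
Local Notation e := (lie_chart1 G (1%g : G)).

Variable sigma : G -> G.
Hypothesis sigma_inv : lie_involution sigma.

Local Notation s := (in_chart sigma).
Local Notation L := (diff1 sigma).

(* [x + psi x] is the average of the chart with its conjugate by the involution,
   a coordinate in which the involution is linear. *)
Let psi (x : 'rV[R]_n) := 2^-1 *: (L (s (e + x) - e) - x).

Let s1 : s e = e.
Proof. by rewrite /in_chart chart_inv1 sigma1. Qed.

Let LB u v : L (u - v) = L u - L v.
Proof.
have /= h := diff1_sigma_linear sigma_inv (-1) v u.
by rewrite -[in LHS](scaleN1r v) (addrC u) h scaleN1r addrC.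
Qed.

Let L0 : L 0 = 0.
Proof. by rewrite -{1}(subrr 0) LB subrr. Qed.

Let LD u v : L (u + v) = L u + L v.
Proof. by rewrite -{1}[v]opprK LB -[- v]add0r LB L0 sub0r opprK. Qed.

Let LZ k v : L (k *: v) = k *: L v.
Proof.
by have /= h := diff1_sigma_linear sigma_inv k v 0; rewrite -[k *: v]addr0 h L0 addr0.
Qed.

Let psi0 : psi 0 = 0.
Proof.
by rewrite /psi addr0 s1 subrr L0 subrr scaler0.
Qed.

(** The derivative of [psi] at 0 is (L L - 1) / 2 = 0, as L is an involution; strict
    differentiability of the involution in the chart turns this into a small Lipschitz constant. *)
Let psi_small (ep : R) : 0 < ep -> exists2 d : R, 0 < d & forall x y,
  `|x| < d -> `|y| < d -> `|psi y - psi x| <= ep * `|y - x|.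
Proof.
move=> ep0.
have lL : linear L := diff1_sigma_linear sigma_inv.
have [C C0 hC] : exists2 C : R, 0 < C & forall v, `|L v| <= C * `|v|.
  have cL : continuous L.
    by move=> x; exact: differentiable_continuous (linear_rV_differentiable _ lL).
  pose LL : {linear 'rV[R]_n -> 'rV[R]_n} := HB.pack L (GRing.isLinear.Build _ _ _ _ _ lL).
  by have [C C0 hC] := @linear_lipschitz _ _ _ LL cL; exists C.
have e1 : 0 < ep / C by rewrite divr_gt0.
have [ss _ _] := sigma_inv; have [c N] := smooth_map_chart1 ss (sigma1 sigma_inv).
have [d d0 hd] := class_C1_strict c N e1.
exists d => // x y xd yd.
have := hd (e + x) (e + y); rewrite -!/(in_chart sigma _) !(addrC e) !addrK => /(_ xd yd).
rewrite opprD addrACA subrr addr0 -diff1_in_chart => h.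
have -> : psi y - psi x = 2^-1 *: L (s (y + e) - s (x + e) - L (y - x)).
  rewrite /psi -scalerBr; congr (_ *: _).
  rewrite !LB (diff1_sigmaK sigma_inv) (diff1_sigmaK sigma_inv) !(addrC e).
  have alg (A B D u v : 'rV[R]_n) : (A - D - v) - (B - D - u) = A - B - (v - u).
    by apply/rowP => i; rewrite !mxE; ring.
  exact: alg.
rewrite normrZ ger0_norm ?invr_ge0//.
apply: le_trans (_ : 2^-1 * (C * (ep / C * `|y - x|)) <= _).
  by rewrite ler_wpM2l ?invr_ge0// (le_trans (hC _))// ler_wpM2l// ltW.
rewrite !mulrA; apply: ler_wpM2r => //.
have -> : 2^-1 * C * ep / C = 2^-1 * ep by field; rewrite gt_eqF.
by rewrite ger_pMl//; lra.
Qed.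


Let sigma_coord : \forall x \near e,
  [/\ chart_dom a (p x), a (p x) = x, {for x, continuous p},
      p (s x) = sigma (p x) & s (s x) = x].
Proof.
have h1 : \forall x \near e, chart_dom a (sigma (p x)) /\ p (a (sigma (p x))) = sigma (p x).
  apply: (@near_chart_inv1 _ _ G (fun g => chart_dom a (sigma g) /\ p (a (sigma g)) = sigma g)).
  have := @sigma_continuous _ _ G _ sigma_inv 1%g.
  by rewrite /continuous_at sigma1// => /(_ _ (@near_chart_dom1 _ _ G)).
apply: filterS2 h1 (@near_chart1 _ _ G) => x [d1 e1] [d2 e2 c]; split => //.
by have [_ _ ss] := sigma_inv; rewrite /in_chart e1 ss.
Qed.

(** With phi x = x + psi x, the curve solves phi(x(t)) = t Z for small t. As phi conjugates the
    involution to L and L Z = Z, uniqueness of the solution makes it a curve of fixed points. [P]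
    stands for any further condition valid near 1. *)
Lemma fixed_curve Z (P : G -> Prop) : L Z = Z -> (\forall g \near (1%g : G), P g) ->
  exists c : R -> G, has_velocity c Z /\
    forall t, connected_component (fixed_group sigma) 1%g (c t) /\ P (c t).
Proof.
move=> LZZ NP.
(* The constant 1/2 is the one in [solve_perturbed_identity]; it also makes x + psi x injective. *)
have [d1 d10 lip] := @psi_small 2^-1 (ltac:(by rewrite invr_gt0)).
have inj x y : `|x| < d1 -> `|y| < d1 -> x + psi x = y + psi y -> x = y.
  move=> xd yd exy; have := lip x y xd yd.
  have -> : psi y - psi x = x - y.
    have -> : psi y = x + psi x - y by rewrite exy (addrC y) addrK.
    by rewrite addrAC addrK.
  rewrite distrC => h; apply/eqP; rewrite -subr_eq0 -normr_le0 distrC.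
  have := normr_ge0 (y - x); lra.
pose ok x := [/\ chart_dom a (p (e + x)), a (p (e + x)) = e + x,
  {for e + x, continuous p}, p (s (e + x)) = sigma (p (e + x)) & s (s (e + x)) = e + x]
  /\ (P (p (e + x)) /\ `|s (e + x) - e| < d1).
have [d2 d20 hok] : exists2 d2 : R, 0 < d2 & forall x, `|x| < d2 -> ok x.
  have : \forall y \near e, [/\ chart_dom a (p y), a (p y) = y,
    {for y, continuous p}, p (s y) = sigma (p y) & s (s y) = y] /\ (P (p y) /\ `|s y - e| < d1).
    near=> y; split; first by near: y; exact: sigma_coord.
    split; first by near: y; exact: near_chart_inv1.
    rewrite distrC -{1}s1; near: y.
    have /cvgrPdist_lt := differentiable_continuous (sigma_differentiable sigma_inv).
    exact.
  move=> /nbhs_ballP[d2 /= d20 h]; exists d2 => // x xd; apply: h.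
  by rewrite -ball_normE /= opprD addrA subrr add0r normrN.
pose d := Num.min d1 d2 / 2.
have m0 : 0 < Num.min d1 d2 by rewrite lt_min d10.
have d0 : 0 < d by rewrite divr_gt0.
have dm : d < Num.min d1 d2 by rewrite /d; lra.
have [dd1 dd2] : d < d1 /\ d < d2 by move: dm; rewrite lt_min => /andP[].
(* The image of x under the involution has phi-value L Y = Y, the same as x; it lies in the ball of
   injectivity by the last clause of [ok]. *)
have fix_ok x Y : `|x| <= d -> L Y = Y -> x + psi x = Y -> s (e + x) = e + x.
  move=> xd LY xY.
  have [[_ _ _ _ ssx] [_ sxd]] := hok x (le_lt_trans xd dd2).
  suff : s (e + x) - e = x by move=> h; apply: (addIr (- e)); rewrite h addrAC subrr add0r.
  apply: inj => //; first exact: le_lt_trans dd1.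
  rewrite xY -LY -xY LD /psi -!/(in_chart sigma _) [e + (s _ - e)]addrC subrK ssx.
  rewrite [e + x - e]addrAC subrr add0r LZ LB (diff1_sigmaK sigma_inv).
  move: (s (e + x) - e) (L x) => u v.
  by apply/rowP => i; rewrite !mxE; field.
have cpsi x : `|x| <= d -> {for x, continuous psi}.
  move=> xd; apply: continuous_from_bound => ep ep0.
  exists (Num.min (d1 - d) ep) => [|y]; first by rewrite lt_min subr_gt0 dd1.
  rewrite lt_min => /andP[h1 h2].
  have xd1 := le_lt_trans xd dd1.
  have yd1 : `|y| < d1.
    have := ler_normB x (x - y); rewrite opprB addrC subrK => h3; lra.
  have := lip y x yd1 xd1; have := normr_ge0 (x - y); lra.
have lipd x y : `|x| <= d -> `|y| <= d -> `|psi y - psi x| <= 2^-1 * `|y - x|.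
  by move=> xd yd; apply: lip; apply: le_lt_trans dd1.
have solve := solve_perturbed_identity d0 psi0 cpsi lipd.
(* Chosen so that t Z stays in the ball of radius d / 2 where the equation is solvable; the summand
   1 allows Z = 0. *)
pose r := d / 2 / (`|Z| + 1).
have Z1 : 0 < `|Z| + 1 by rewrite ltr_wpDl.
have r0 : 0 < r by rewrite !divr_gt0.
(* The curve has to lie in the group for every real t, so time is clamped to [-r, r]; near 0 nothing
   changes. *)
pose tau (t : R) := Num.max (- r) (Num.min r t).
have tauE t : `|t| <= r -> tau t = t.
  rewrite ler_norml /tau => /andP[h1 h2].
  by rewrite (min_r h2) (max_r h1).
have taur t : `|tau t| <= r.
  rewrite ler_norml /tau le_max lexx /= ge_max ge_min lexx /= andbT.
  by rewrite ge0_cp// ltW.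
have tau_lip t u : `|tau t - tau u| <= `|t - u|. by apply: clamp_lipschitz; exact: ltW.
have small t : `|tau t *: Z| <= d / 2.
  rewrite normrZ (@le_trans _ _ (r * `|Z|))// ?ler_wpM2r//.
  have -> : r * `|Z| = d / 2 * `|Z| / (`|Z| + 1) by rewrite /r mulrAC.
  rewrite ler_pdivrMr// mulrDr mulr1 lerDl; lra.
have /choice[x hx] : forall t, exists x, `|x| <= d /\ x + psi x = tau t *: Z.
  by move=> t; have [x x1 x2] := solve _ (small t); exists x.
(* As [psi] is 1/2-Lipschitz, the inverse of phi is 2-Lipschitz. *)
have xlip t u : `|x t - x u| <= 2 * `|Z| * `|t - u|.
  have [x1 e1] := hx t; have [x2 e2] := hx u.
  have h := lipd _ _ x2 x1.
  have E : x t - x u = (tau t - tau u) *: Z - (psi (x t) - psi (x u)).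
    have alg (A B C D : 'rV[R]_n) : A - C = (A + B) - (C + D) - (B - D).
      by apply/rowP => i; rewrite !mxE; ring.
    by rewrite scalerBl -e1 -e2; exact: alg.
  have h2 : `|(tau t - tau u) *: Z| <= `|Z| * `|t - u|.
    by rewrite normrZ mulrC ler_wpM2l.
  have := ler_normB ((tau t - tau u) *: Z) (psi (x t) - psi (x u)).
  rewrite -E => h3; lra.
have tau0 : tau 0 = 0 by rewrite tauE// normr0 ltW.
have x0 : x 0 = 0.
  have [x1 e1] := hx 0; apply: inj; rewrite ?normr0//; first exact: le_lt_trans dd1.
  by rewrite e1 tau0 scale0r psi0 addr0.
have cl : continuous (fun t => e + x t).
  move=> t; apply: continuous_from_bound => ep ep0.
  have Z2 : 0 < 2 * `|Z| + 1 by rewrite ltr_wpDl// mulr_ge0.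
  exists (ep / (2 * `|Z| + 1)) => [|u]; first by rewrite divr_gt0.
  rewrite ltr_pdivlMr// mulrDr mulr1 => h.
  rewrite opprD addrACA subrr add0r (le_trans (xlip t u))//; have := normr_ge0 (t - u); lra.
(* For |h| <= r the clamp is inactive and x h - h Z = - psi (x h), which is o(h) by [psi_small] and
   |x h| <= 2 |Z| |h|. *)
have dx : is_derive (0 : R) 1 x Z.
  apply: is_derive_from_bound => ep ep0.
  have ep1 : 0 < ep / (2 * `|Z| + 1).
    by rewrite divr_gt0// ltr_wpDl// mulr_ge0.
  have [d3 d30 h3] := psi_small ep1.
  exists (Num.min r (d3 / (2 * `|Z| + 1))) => [|h].
    by rewrite lt_min r0 divr_gt0// ltr_wpDl// mulr_ge0.
  rewrite lt_min => /andP[hr hd3]; rewrite x0 subr0.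
  have [x1 e1] := hx h.
  have -> : x h - h *: Z = - psi (x h).
    have -> : h *: Z = x h + psi (x h) by rewrite e1 tauE// ltW.
    by rewrite opprD addrA subrr add0r.
  rewrite normrN.
  have xh := xlip h 0; rewrite x0 !subr0 in xh.
  have Z2 : 0 < 2 * `|Z| + 1 by rewrite ltr_wpDl// mulr_ge0.
  move: hd3; rewrite ltr_pdivlMr// mulrDr mulr1 => hd3.
  have h4 : `|x h| < d3 by have := normr_ge0 h; lra.
  have := h3 0 (x h); rewrite normr0 psi0 !subr0 => /(_ d30 h4) /le_trans; apply.
  rewrite mulrAC ler_pdivrMr// -mulrA ler_wpM2l ?(ltW ep0)// (le_trans xh)//.
  by rewrite mulrC ler_wpM2l// lerDl.
exists (fun t => p (e + x t)).
have cc : continuous (fun t => p (e + x t)).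
  move=> t; apply: (continuous_comp (f := fun t => e + x t) (g := p)); first exact: cl.
  by have [x1 _] := hx t; have [[]] := hok _ (le_lt_trans x1 dd2).
split.
  split; first by rewrite x0 addr0 chart_inv1.
    exact: cc.
  have -> : a \o (fun t => p (e + x t)) = (fun t => e + x t).
    by apply/funext => t /=; have [x1 _] := hx t; have [[]] := hok _ (le_lt_trans x1 dd2).
  by have := is_deriveD (is_derive_cst e (0 : R) 1) dx; rewrite add0r.
move=> t; split; last first.
  by have [x1 _] := hx t; have [_ []] := hok _ (le_lt_trans x1 dd2).
(* The image of the real line is connected, contains 1 and consists of fixed points. *)
apply: (@connected_component_max _ _ [set p (e + x t) | t in [set: R]]).
- by exists 0; rewrite // x0 addr0 chart_inv1.
- move=> _ [u _ <-] /=; have [x1 e1] := hx u.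
  have [[_ _ _ h _] _] := hok _ (le_lt_trans x1 dd2).
  rewrite /fixed_group /= -h (fix_ok _ _ x1 _ e1)//.
  by rewrite LZ LZZ.
- apply: connected_continuous_connected.
    by apply/connected_intervalP => u v _ _ w _.
  exact: continuous_subspaceT.
- by exists t.
Unshelve. all: by end_near. Qed.

End FixedCurve.

(** * The shape operator of the orbit *)

Section AdjointAutomorphism.
Context {R : realType} {n : nat} (G : lieGroup R n).
Implicit Types (g : G) (Y Z : 'rV[R]_n).

Lemma Ad_0 g : Ad_regular g -> Ad g 0 = 0.
Proof.
move=> /Ad_regular_linear lin; have := lin (-1) 0 0.
by rewrite !scaleN1r oppr0 addr0 addNr.
Qed.

Lemma Ad_opp g Y : Ad_regular g -> Ad g (- Y) = - Ad g Y.
Proof.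
move=> reg; have := Ad_regular_linear reg (-1) Y 0.
by rewrite !scaleN1r (Ad_0 reg) !addr0.
Qed.

Lemma killing_Ad g Y Z : Ad_regular g -> Ad_regular g^-1%g ->
  killing G (Ad g Y) (Ad g Z) = killing G Y Z.
Proof.
move=> reg regV.
have AE : linfun (Ad g) =1 Ad g by apply: linfunE; apply: (Ad_regular_linear reg).
have A'E : linfun (Ad g^-1%g) =1 Ad g^-1%g.
  by apply: linfunE; apply: (Ad_regular_linear regV).
rewrite -!AE.
apply: (@killing_aut _ _ (bracket G) (@bracket_linearr _ _ G)
          (linfun (Ad g)) (linfun (Ad g^-1%g)) Y Z).
- by move=> v; rewrite A'E AE -(AdM v regV reg) mulVg Ad1.
- by move=> v; rewrite AE A'E -(AdM v reg regV) mulgV Ad1.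
by move=> u v; rewrite !AE; apply: Ad_bracket.
Qed.

End AdjointAutomorphism.

Section Shape.
Context {R : realType} {n : nat} (G : lieGroup R n).
Hypothesis G_semisimple : semisimple_lie G.
Variable sigma : G -> G.
Hypothesis sigma_inv : lie_involution sigma.
Variable H : set G.
Hypothesis H_subgroup : subgroup H.
Hypothesis H_lower : connected_component (fixed_group sigma) 1%g `<=` H.
Hypothesis H_upper : H `<=` fixed_group sigma.
Variables (r : R) (X : 'rV[R]_n).
Hypothesis X_q : X \in lie_q sigma.
Hypothesis M_pseudo : pseudo_riemannian_orbit sigma H r X.
Implicit Types (Y Z W : 'rV[R]_n).

Local Notation br := (bracket G).
Local Notation a := (lie_chart1 G).
Local Notation T := (orbit_tangent sigma X).

Let br_ll : forall y, linear (br^~ y) := @bracket_linearl _ _ G.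
Let br_lr : forall x, linear (br x) := @bracket_linearr _ _ G.
Let br_a : forall x y, br x y = - br y x := @bracket_anti _ _ G.
Let br_j : forall x y z, br x (br y z) = br (br x y) z + br y (br x z) := @jacobi _ _ G.

Lemma dsigmaE v : dsigma sigma v = diff1 sigma v.
Proof. by rewrite /dsigma linfunE//; exact: diff1_sigma_linear. Qed.

Lemma mem_lie_h v : v \in lie_h sigma <-> dsigma sigma v = v.
Proof.
rewrite /lie_h memv_ker add_lfunE opp_lfunE scale_lfunE id_lfunE scale1r subr_eq0.
by split=> /eqP.
Qed.

Lemma mem_lie_q v : v \in lie_q sigma <-> dsigma sigma v = - v.
Proof.
rewrite /lie_q memv_ker add_lfunE opp_lfunE scale_lfunE id_lfunE scaleN1r opprK.
by rewrite addr_eq0; split=> /eqP.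
Qed.

Let sK v : dsigma sigma (dsigma sigma v) = v.
Proof. by rewrite !dsigmaE diff1_sigmaK. Qed.

Let s_br x y : dsigma sigma (br x y) = br (dsigma sigma x) (dsigma sigma y).
Proof. by rewrite !dsigmaE diff1_sigma_bracket. Qed.

Let Xq : dsigma sigma X = - X.
Proof. exact/mem_lie_q. Qed.

Let memT v : v \in T <-> exists2 Z, dsigma sigma Z = Z & v = br Z X.
Proof.
rewrite /orbit_tangent; split=> [/memv_imgP[Z /mem_lie_h Zh ->]|[Z Zh ->]].
  by exists Z => //; rewrite linfunE//; exact: br_ll.
have -> : br Z X = linfun (fun Z => br Z X) Z by rewrite linfunE//; exact: br_ll.
by apply: memv_img; apply/mem_lie_h.
Qed.

Let T_nondeg v : v \in T -> (forall w, w \in T -> killing_form br v w = 0) -> v = 0.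
Proof.
move=> vT; apply: M_pseudo.2 => //; exists 1%g; last exact: Ad1.
by have [] := H_subgroup.
Qed.

Let nondeg x : (forall y, killing_form br x y = 0) -> x = 0.
Proof. exact: G_semisimple. Qed.

Let B0l W : killing G 0 W = 0.
Proof.
rewrite -[killing G]/(killing_form br).
have := killing_linearl br_ll br_lr W (-1) 0 0.
by rewrite scaleN1r oppr0 addr0 mulN1r addNr.
Qed.

(** X is orthogonal to the tangent space of its orbit, so the radial term of [sphere_proj]
    disappears when paired with tangent vectors. *)
Let BX W : killing G X (br W X) = 0.
Proof.
rewrite -[killing G]/(killing_form br) killingC killing_invariant//.
have -> : br X X = 0.
  have /eqP := br_a X X; rewrite -addr_eq0 -mulr2n -scaler_nat scaler_eq0.
  by rewrite pnatr_eq0 /= => /eqP.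
by rewrite killingC; exact: B0l.
Qed.

(** Differentiating [nu(t), Ad(c t) X] = 0 at 0 gives [X, nu'(0)] = [y, v]. Hence nu'(0) pairs with
    [W, X] as W pairs with [y, v], which [shape_end_killing] computes. *)
Lemma shape_end_is_shape_operator y : orbit_normal sigma X y ->
  is_shape_operator H y (shape_end br X T y).
Proof.
move=> [yq yX yB] c nu cH c0 cc dc nuN nu0 dnu v w vE.
have hc : has_velocity c ('D_1 (a \o c) 0).
  by split; [exact: c0 | exact: cc | apply/derivableP; exact: dc].
have dAd := Ad_curve X hc.
have /memT[W Wh wE] := subvsP w.
have vb : vsval v = br ('D_1 (a \o c) 0) X.
  by rewrite vE derive1E; case: dAd.
have dnu' : is_derive (0 : R) 1 nu (derive1 nu 0) by rewrite derive1E; apply/derivableP.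
have e0 : br (derive1 nu 0) X + br y (vsval v) = 0.
  have := bilinear_is_derive br_lr br_ll dnu' dAd.
  rewrite c0 Ad1 nu0 -vb => h.
  have hz : is_derive (0 : R) 1 (fun _ : R => (0 : 'rV[R]_n)) 0 := is_derive_cst 0 _ _.
  have hE : (fun t => br (nu t) (Ad (c t) X)) = (fun=> 0).
    by apply/funext => t; have [_ e _] := nuN t.
  by apply: is_derive_unique hz; rewrite -hE.
have e1 : br X (derive1 nu 0) = br y (vsval v).
  rewrite (br_a X (derive1 nu 0)); apply/esym/eqP.
  by rewrite -addr_eq0 addrC e0.
rewrite wE -[killing G]/(killing_form br).
have yq' : dsigma sigma y = - y by apply/mem_lie_q.
have E := shape_end_killing br_ll br_lr br_a br_j nondeg sK s_br Xq memT T_nondeg yq' yX v Wh.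
apply: (etrans E); apply: (congr1 -%R).
rewrite /sphere_proj; set k := _ / _; set d := derive1 nu 0.
have -> : killing_form br (d - k *: X) (br W X) = killing_form br d (br W X).
  have := killing_linearl br_ll br_lr (br W X) (- k) X d.
  rewrite (BX W : killing_form br X (br W X) = 0) mulr0 add0r => <-.
  by rewrite scaleNr addrC.
apply: esym; apply: (etrans (killingC br d (br W X))).
apply: (etrans (killing_invariant br_lr br_j _ _ _)).
exact: (congr1 (killing_form br W) e1).
Qed.

(** The operator picked by [xget] agrees with [shape_end] because the condition has at most one
    solution: [fixed_curve] realises every tangent vector as a velocity, Ad(c t) y is a normal field
    along that curve, and the metric on [T] is nondegenerate. *)
Lemma shape_operatorE y : orbit_normal sigma X y ->
  shape_operator sigma H X y = shape_end br X T y.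
Proof.
move=> yN; rewrite /shape_operator.
have is1 := shape_end_is_shape_operator yN.
case: xgetP => [A' _ /= is2|/(_ _ is1)//].
have [yq yX yB] := yN.
apply/lfunP => v; apply: val_inj.
set p := val (A' v); set q := val (shape_end br X T y v).
apply/eqP; rewrite -subr_eq0; apply/eqP; apply: T_nondeg.
  by apply: memvB; exact: subvsP.
move=> w wT.
have /memT[Z Zh vE] := subvsP v.
(* Invariance of the Killing form under Ad(g) is derived from the inverse Ad(g^-1), hence the
   condition on both elements. *)
pose P (g : G) := Ad_regular g /\ Ad_regular g^-1%g.
have NP : \forall g \near (1%g : G), P g.
  have h1 := @near_Ad_regular _ _ G.
  by apply: filterS2 h1 (near_invg h1).
have Zh' : diff1 sigma Z = Z by rewrite -dsigmaE.
have [c [hc cP]] := fixed_curve sigma_inv Zh' NP.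
have [c0 cc dc] := hc.
have cH t : H (c t) by apply: H_lower; have [] := cP t.
have nuN t : orbit_normal sigma (Ad (c t) X) (Ad (c t) y).
  have [_ [reg regV]] := cP t; have fc : sigma (c t) = c t by exact: H_upper.
  have lin := Ad_regular_linear reg.
  split.
  - apply/mem_lie_q; rewrite dsigmaE (diff1_sigma_Ad sigma_inv) ?fc//.
    rewrite -dsigmaE; have /mem_lie_q -> := yq.
    exact: Ad_opp.
  - by rewrite -Ad_bracket// yX Ad_0.
  - by rewrite killing_Ad.
have dX := Ad_curve X hc; have dy := Ad_curve y hc.
have vD : vsval v = derive1 (fun t : R => Ad (c t) X) 0.
  by rewrite vE derive1E; case: dX => _ ->.
have y0 : Ad (c 0) y = y by rewrite c0 Ad1.
have dc' : derivable (fun t => a (c t)) 0 1 by case: dc.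
have dnu : derivable (fun t : R => Ad (c t) y) 0 1 by case: dy.
have e1 := is1 c _ cH c0 cc dc' nuN y0 dnu v (vsproj T w) vD.
have e2 := is2 c _ cH c0 cc dc' nuN y0 dnu v (vsproj T w) vD.
have pq : killing_form br p (vsval (vsproj T w)) = killing_form br q (vsval (vsproj T w)).
  exact: (etrans e2 (esym e1)).
have sw : vsval (vsproj T w) = w := vsprojK wT.
rewrite sw in pq.
have := killing_linearl br_ll br_lr w (-1) q p.
by rewrite mulN1r pq addNr scaleN1r addrC.
Qed.

Lemma shape_operator_jordan xi xis xin : orbit_normal sigma X xi ->
  lie_jordan_chevalley G xi xis xin ->
  jordan_chevalley (shape_operator sigma H X xi)
    (shape_operator sigma H X xis) (shape_operator sigma H X xin).
Proof.
move=> xiN [e ss nn c]; have [xiq xiX xiB] := xiN.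
have xiq' : dsigma sigma xi = - xi by apply/mem_lie_q.
have [sX nX] := jordan_centralizer br_ll br_lr br_j e ss nn c xiX.
have [sq nq] := jordan_q br_ll br_lr br_a br_j nondeg sK s_br e ss nn c xiq'.
have [sB nB] := jordan_killing br_ll br_lr br_j e ss nn c xiX xiB.
have xisN : orbit_normal sigma X xis.
  by split; [apply/mem_lie_q; exact: sq | exact: sX | exact: sB].
have xinN : orbit_normal sigma X xin.
  by split; [apply/mem_lie_q; exact: nq | exact: nX | exact: nB].
rewrite (shape_operatorE xiN) (shape_operatorE xisN) (shape_operatorE xinN).
exact: (shape_end_jordan br_ll br_lr br_a br_j nondeg sK s_br Xq memT T_nondeg
          xiq' xiX e ss nn c).
Qed.

End Shape.

Theorem proposition2p2 (R : realType) (n : nat) (G : lieGroup R n)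
  (G_connected : connected [set: G])
  (G_semisimple : semisimple_lie G)
  (G_noncompact : ~ compact [set: G])
  (sigma : G -> G) (sigma_involution : lie_involution sigma)
  (H : set G) (H_subgroup : subgroup H) (H_closed : closed H)
  (H_lower : connected_component (fixed_group sigma) 1%g `<=` H)
  (H_upper : H `<=` fixed_group sigma)
  (r : R) (r_gt0 : 0 < r)
  (X : 'rV[R]_n) (X_q : X \in lie_q sigma)
  (M_pseudo : pseudo_riemannian_orbit sigma H r X)
  (xi xis xin : 'rV[R]_n) (xi_normal : orbit_normal sigma X xi)
  (xi_JC : lie_jordan_chevalley G xi xis xin) :
  jordan_chevalley (shape_operator sigma H X xi)
                   (shape_operator sigma H X xis)
                   (shape_operator sigma H X xin).
Proof.
exact: (shape_operator_jordan G_semisimple sigma_involution H_subgroup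
          H_lower H_upper X_q M_pseudo xi_normal xi_JC).
Qed.
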